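(* Let $P$ be a computable probability measure on $\Omega=\{0,1\}^{\mathbb{N}}$ with $P(x)>0$ for every binary word $x$. Then for all binary words $x$, $$\frac{\mathbf{m}(x)}{P(x)}\ \stackrel{\cdot}{<}\ \mathbf{t}_P(x)\ \stackrel{\cdot}{<}\ \hat{\mathbf{t}}_P(x)\ \stackrel{\cdot}{<}\ \frac{\mathbf{a}(x)}{P(x)},$$ where $f\stackrel{\cdot}{<}g$ means $f(x)\le c\,g(x)$ for some constant $c$ and all $x$.
   Context: $P(x)=P(x\Omega)$ is the measure of the set of sequences beginning with $x$. An extended test for $P$ is a function $T:\{0,1\}^*\to[0,+\infty]$ that is lower semicomputable (the set of pairs $(x,r)$, $r$ rational, $r<T(x)$, is enumerable), monotone ($T(x)\le T(y)$ whenever $x$ is a prefix of $y$), and satisfies $\sum_{|x|=N}P(x)T(x)\le 1$ for every $N$. $\mathbf{t}_P(x)$ denotes a universal extended test, i.e. an extended test dominating every extended test up to a multiplicative constant (it exists). Also $\mathbf{t}_P(\omega)$ for $\omega\in\Omega$ denotes a universal expectation-bounded $P$-test (a lower semicomputable function $t:\Omega\to[0,\infty]$ — meaning each $\{\omega: r<t(\omega)\}$, $r$ rational, is an effectively open set uniformly in $r$ — with $\int t\,dP\le1$, maximal up to a constant factor), and $\hat{\mathbf{t}}_P(x)=\frac{1}{P(x)}\int_{x\Omega}\mathbf{t}_P(\omega)\,dP(\omega)$. $\mathbf{m}(x)=2^{-\mathit{Kp}(x)}$ is the discrete a priori probability ($\mathit{Kp}$ = prefix complexity). $\mathbf{a}(x)$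 is the continuous a priori probability: a maximal (up to a multiplicative constant) lower semicomputable semimeasure on the binary tree, where a semimeasure on the tree is a function $M\ge 0$ on words with $M(\Lambda)=1$ for the empty word $\Lambda$ and $M(x)\ge M(x0)+M(x1)$. *)

(* Defs.v *)
From HB Require Import structures.
From mathcomp Require Export all_boot all_order all_algebra.
From mathcomp Require Export all_classical all_reals all_analysis.

Set Implicit Arguments.
Unset Strict Implicit.
Unset Printing Implicit Defensive.

Import Order.TTheory GRing.Theory Num.Theory.

Local Open Scope classical_set_scope.
Local Open Scope ring_scope.

(* Kleene's partial recursive functions. Arities are not tracked: a missing
   argument is read as 0. In [RPrec] the recursion argument comes first, and
   the step function receives the index, the previous value, the parameters. *)

Inductive recfun : Type :=
| RZero
| RSucc
| RProj of nat
| RComp (m : nat) of recfun & ('I_m -> recfun)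
| RPrec of recfun & recfun
| RMu of recfun.

(* [reval c v y]: the function with program [c] is defined at [v], with value
   [y]. *)
Fixpoint reval (c : recfun) (v : seq nat) (y : nat) : Prop :=
  match c with
  | RZero => y = 0%N
  | RSucc => y = (head 0%N v).+1
  | RProj i => y = nth 0%N v i
  | RComp m f g => exists w : m.-tuple nat,
      (forall i : 'I_m, reval (g i) v (tnth w i)) /\ reval f w y
  | RPrec f g => exists s : nat -> nat,
      [/\ reval f (behead v) (s 0%N),
          forall i, (i < head 0%N v)%N ->
            reval g [:: i, s i & behead v] (s i.+1)
        & y = s (head 0%N v)]
  | RMu f =>
      reval f (y :: v) 0%N /\
      forall i, (i < y)%N -> exists z, reval f (i :: v) z.+1
  end.

Definition word := seq bool.

(* A bijection between words and natural numbers (dyadic notation). *)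
Fixpoint word_code (x : word) : nat :=
  if x is b :: y then ((word_code y).*2 + b).+1 else 0%N.

(* [enc] presents an element of [A] as a list of natural number arguments. *)
Definition computable (A : Type) (enc : A -> seq nat) (f : A -> nat) : Prop :=
  exists c, forall a, reval c (enc a) (f a).

Definition computable_rat (A : Type) (enc : A -> seq nat) (f : A -> rat) :
    Prop :=
  exists a b d : A -> nat,
    [/\ computable enc a, computable enc b, computable enc d
      & forall z, f z = ((a z)%:R - (b z)%:R) / (d z).+1%:R].

(* As [word_code] is onto, [c] diverges exactly where [f] is [None]. *)
Definition partial_computable (f : word -> option word) : Prop :=
  exists c, forall p x, f p = Some x <-> reval c [:: word_code p] (word_code x).

(* An algorithm lists the elements of [W]; [e k] tells whether an element is
   produced at step [k], so that [W] may be empty. *)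
Definition enumerable (W : set (word * rat)) : Prop :=
  exists (e : nat -> bool) (u : nat -> word) (q : nat -> rat),
    [/\ computable (fun k => [:: k]) (fun k => nat_of_bool (e k)),
        computable (fun k => [:: k]) (fun k => word_code (u k)),
        computable_rat (fun k => [:: k]) q
      & forall x r, W (x, r) <-> exists k, [/\ e k, u k = x & q k = r]].

Definition cylinder (x : word) : set (nat -> bool) :=
  [set w | mkseq w (size x) = x].

Definition Omega := g_sigma_algebraType (range cylinder).

Definition dominated (R : realType) (A : Type) (f g : A -> \bar R) : Prop :=
  exists2 c : R, 0 < c & forall a, (f a <= c%:E * g a)%E.

Definition wmeasure (R : realType) (P : probability Omega R) (x : word) : R :=
  fine (P (cylinder x)).

Definition computable_measure (R : realType) (P : probability Omega R) : Prop :=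
  exists q : word * nat -> rat,
    computable_rat (fun z => [:: word_code z.1; z.2]) q /\
    forall x n, `|wmeasure P x - ratr (q (x, n))| <= 2 ^- n.

Definition lower_semicomputable (R : realType) (f : word -> \bar R) : Prop :=
  enumerable [set z | ((ratr z.2)%:E < f z.1)%E].

Definition extended_test (R : realType) (P : probability Omega R)
    (T : word -> \bar R) : Prop :=
  [/\ forall x, (0 <= T x)%E,
      lower_semicomputable T,
      forall x y, prefix x y -> (T x <= T y)%E
    & forall N, (\sum_(x : N.-tuple bool) (wmeasure P x)%:E * T x <= 1)%E].

Definition universal_extended_test (R : realType) (P : probability Omega R)
    (T : word -> \bar R) : Prop :=
  extended_test P T /\ forall T', extended_test P T' -> dominated T' T.

(* The sets {w | r < t w} are effectively open, uniformly in the rational r. *)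
Definition lower_semicomputable_Omega (R : realType) (t : Omega -> \bar R) :
    Prop :=
  exists2 W : set (word * rat), enumerable W &
    forall r : rat, [set w | ((ratr r)%:E < t w)%E] =
      \bigcup_(x in [set x | W (x, r)]) cylinder x.

Definition expectation_bounded_test (R : realType) (P : probability Omega R)
    (t : Omega -> \bar R) : Prop :=
  [/\ forall w, (0 <= t w)%E,
      lower_semicomputable_Omega t
    & (\int[P]_w t w <= 1)%E].

Definition universal_expectation_bounded_test (R : realType)
    (P : probability Omega R) (t : Omega -> \bar R) : Prop :=
  expectation_bounded_test P t /\
  forall t', expectation_bounded_test P t' -> dominated t' t.

Definition test_average (R : realType) (P : probability Omega R)
    (t : Omega -> \bar R) (x : word) : \bar R :=
  ((wmeasure P x)^-1%:E * \int[P]_(w in cylinder x) t w)%E.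

Definition prefix_machine (U : word -> option word) : Prop :=
  partial_computable U /\
  forall p q, U p -> U q -> prefix p q -> p = q.

(* The least length of a program for [x], +oo if there is none. *)
Definition complexity (R : realType) (U : word -> option word) (x : word) :
    \bar R :=
  ereal_inf [set (size p)%:R%:E | p in [set p | U p = Some x]].

Definition optimal_prefix_machine (R : realType) (U : word -> option word) :
    Prop :=
  prefix_machine U /\
  forall V, prefix_machine V ->
    exists c : R, forall x, (complexity R U x <= complexity R V x + c%:E)%E.

Definition discrete_apriori (R : realType) (U : word -> option word)
    (x : word) : \bar R :=
  match complexity R U x with
  | EFin k => (2 `^ (- k))%:E
  | EPInf => 0%E
  | ENInf => +oo%E
  end.

Definition semimeasure (R : realType) (M : word -> R) : Prop :=
  [/\ forall x, 0 <= M x,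
      M [::] = 1
    & forall x, M (rcons x false) + M (rcons x true) <= M x].

Definition lower_semicomputable_semimeasure (R : realType) (M : word -> R) :
    Prop :=
  semimeasure M /\ lower_semicomputable (EFin \o M).

Definition continuous_apriori (R : realType) (a : word -> R) : Prop :=
  lower_semicomputable_semimeasure a /\
  forall M, lower_semicomputable_semimeasure M ->
    dominated (EFin \o M) (EFin \o a).

(* Main.v *)
From mathcomp Require Import zify lra.
From mathcomp Require Import measurable_realfun.
Require Import Defs.

Set Implicit Arguments.
Unset Strict Implicit.
Unset Printing Implicit Defensive.

(** First inequality: [x |-> sup {m(y) / P(y) : y prefix of x}] is an extended
    test. Replacing the supremum by the sum over the prefixes, its expectation
    at length [N] is at most the sum of [m] over the words of length at most
    [N], which Kraft's inequality bounds by 1.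

    Second inequality: for an extended test [T], monotone convergence makes
    [w |-> sup_n T(w_0 ... w_(n-1))] an expectation-bounded test, hence it is at
    most [c t]; now integrate [T(x) <= c t] over the cylinder of [x].

    Third inequality: [x |-> int_(x Omega) t dP] is additive, and it is lower
    semicomputable since [t] is the increasing limit of step functions, on the
    cylinders of length [n], with computable dyadic values. *)

Local Open Scope classical_set_scope.

(** The inequalities themselves are short; most of the work is to show that the test and the
    semimeasure are lower semicomputable, since this means exhibiting programs. In both cases the
    condition [r < f x] is brought to the form: some tuple of numbers satisfies a recursive
    relation. The lemma [enumerable_sigma1] turns any such form into an enumeration.

    The tuple carries the witnesses: a fuel for a halting computation of the prefix machine, a
    precision for [P], a stage for [t]. A strict inequality between reals is not decidable, but when
    it holds it is visible at some finite precision, and this precision is a witness. The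
    approximations are dyadic with natural numerators, so the relations only compare natural
    numbers.

    The prefix machine is a partial function and [reval] has no notion of time, which is why a
    step-bounded evaluator is built first. *)

Local Open Scope nat_scope.

(** * Closure properties of recursive functions *)

(** Functions on plain lists compose without dependent arities. The length is still fixed, because
    composition passes on only a known number of arguments. *)
Definition recursive (k : nat) (f : seq nat -> nat) : Prop :=
  exists c, forall v, size v = k -> reval c v (f v).

Lemma eq_recursive k f g :
  (forall v, size v = k -> f v = g v) -> recursive k f -> recursive k g.
Proof. by move=> fg [c cf]; exists c => v vk; rewrite -fg //; exact: cf. Qed.

Lemma recursive_nth k i : recursive k (nth 0 ^~ i).
Proof. by exists (RProj i). Qed.

Fixpoint all_recursive k (gs : seq (seq nat -> nat)) : Prop :=
  if gs is g :: gs' then recursive k g /\ all_recursive k gs' else True.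

Lemma all_recursiveP k gs :
  all_recursive k gs <->
  forall i, i < size gs -> recursive k (nth (fun=> 0) gs i).
Proof.
elim: gs => [|g gs IH] //=; split.
  by move=> [rg /IH rgs] [|i] //= /rgs.
by move=> H; split; [exact: (H 0)|apply/IH => i ilt; exact: (H i.+1)].
Qed.

Lemma recursive_comp k f gs : recursive (size gs) f -> all_recursive k gs ->
  recursive k (fun v => f [seq g v | g <- gs]).
Proof.
move=> [cf hf] /all_recursiveP H.
have [cg hg] := choice (fun i : 'I_(size gs) => H i (ltn_ord i)).
exists (RComp cf cg) => v vk /=.
exists [tuple nth (fun=> 0) gs i v | i < size gs]; split.
  by move=> i; rewrite tnth_mktuple; exact: hg.
have -> : [tuple nth (fun=> 0) gs i v | i < size gs] = [seq g v | g <- gs] :> seq nat.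
  apply: (@eq_from_nth _ 0); first by rewrite size_tuple size_map.
  rewrite size_tuple => i ilt.
  rewrite -(tnth_nth 0 _ (Ordinal ilt)) tnth_mktuple.
  by rewrite (nth_map (fun=> 0)).
by apply: hf; rewrite size_map.
Qed.

Lemma all_recursive_nth k js :
  all_recursive k [seq (fun v => nth 0 v i) | i <- js].
Proof. by elim: js => //= j js IH; split=> //; exact: recursive_nth. Qed.

Lemma recursive1 k f g : recursive 1 (fun v => f (nth 0 v 0)) ->
  recursive k g -> recursive k (fun v => f (g v)).
Proof. by move=> rf rg; apply: (@recursive_comp _ (fun v => f (nth 0 v 0)) [:: g]). Qed.

Lemma recursive2 k f g h : recursive 2 (fun v => f (nth 0 v 0) (nth 0 v 1)) ->
  recursive k g -> recursive k h -> recursive k (fun v => f (g v) (h v)).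
Proof.
move=> rf rg rh.
by apply: (@recursive_comp _ (fun v => f (nth 0 v 0) (nth 0 v 1)) [:: g; h]).
Qed.

Lemma recursive_succ k f : recursive k f -> recursive k (fun v => (f v).+1).
Proof. by apply: (recursive1 (f := S)); exists RSucc => v _ /=; rewrite nth0. Qed.

Lemma recursive_const k n : recursive k (fun=> n).
Proof. by elim: n => [|n]; [exists RZero|exact: recursive_succ]. Qed.

(** Composition passes a fixed list of computed arguments, so a tail of the arguments has to be
    written as a list of projections. *)
Lemma map_nth_iota (v : seq nat) j k : size v = j + k ->
  [seq g v | g <- [seq (fun v => nth 0 v i) | i <- iota j k]] = iter j behead v.
Proof.
move=> vk; rewrite -drop_behead -map_comp; apply: (@eq_from_nth _ 0).
  by rewrite size_map size_iota size_drop vk addKn.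
move=> i; rewrite size_map size_iota => ilt.
by rewrite (nth_map 0) ?size_iota // nth_iota // nth_drop.
Qed.

Lemma recursive_behead k f j : recursive k f ->
  recursive (j + k) (fun v => f (iter j behead v)).
Proof.
move=> rf.
apply: (eq_recursive (f := fun v =>
    f [seq g v | g <- [seq (fun v => nth 0 v i) | i <- iota j k]])).
  by move=> v vk; rewrite map_nth_iota.
by apply: recursive_comp; [rewrite size_map size_iota|exact: all_recursive_nth].
Qed.

(** For loop bodies: the [j] entries put in front by the loops (indices, accumulator) are replaced
    by the arguments [gs] that the body expects, and the parameters behind them are kept. *)
Lemma recursive_cons k f (gs : seq (seq nat -> nat)) j :
  recursive (size gs + k) f -> all_recursive (j + k) gs ->
  recursive (j + k) (fun v => f ([seq g v | g <- gs] ++ iter j behead v)).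
Proof.
move=> rf rgs.
apply: (eq_recursive (f := fun v => f [seq g v | g <-
    gs ++ [seq (fun v => nth 0 v i) | i <- iota j k]])).
  by move=> v vk; rewrite map_cat map_nth_iota.
apply: recursive_comp; first by rewrite size_cat size_map size_iota.
elim: gs rgs {rf} => [_|g gs IH [rg rgs]] /=; first exact: all_recursive_nth.
by split=> //; exact: IH.
Qed.

Lemma recursive_iteri k n f g : recursive k n -> recursive k f ->
  recursive k.+2 g ->
  recursive k (fun v => iteri (n v) (fun i s => g [:: i, s & v]) (f v)).
Proof.
move=> rn [cf hf] [cg hg].
(* Primitive recursion reads its bound at the head of the list; the bound is first a separate
   argument, into which [n] is substituted afterwards. *)
have rec : recursive k.+1 (fun v => iteri (head 0 v)
    (fun i s => g [:: i, s & behead v]) (f (behead v))).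
  exists (RPrec cf cg) => -[//|h v] [vk] /=.
  exists (fun j => iteri j (fun i s => g [:: i, s & v]) (f v)); split => //.
    exact: hf.
  by move=> i _ /=; apply: hg; rewrite /= vk.
apply: (eq_recursive (f := fun v => (fun v => iteri (head 0 v)
    (fun i s => g [:: i, s & behead v]) (f (behead v)))
    ([seq g v | g <- [:: n]] ++ iter 0 behead v))).
  by [].
by apply: (recursive_cons (j := 0) (gs := [:: n]) rec).
Qed.

Lemma recursive_add k f g : recursive k f -> recursive k g ->
  recursive k (fun v => f v + g v).
Proof.
move=> rf rg; apply: (eq_recursive (f := fun v =>
    iteri (g v) (fun i s => (nth 0 [:: i, s & v] 1).+1) (f v))).
  by move=> v _ /=; elim: (g v) => [|m /= ->]; rewrite ?addn0 ?addnS.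
by apply: (recursive_iteri (g := fun u => (nth 0 u 1).+1)) => //;
  apply: recursive_succ; exact: recursive_nth.
Qed.

Lemma recursive_pred k f : recursive k f -> recursive k (fun v => (f v).-1).
Proof.
move=> rf; apply: (eq_recursive (f := fun v =>
    iteri (f v) (fun i s => nth 0 [:: i, s & v] 0) 0)).
  by move=> v _; case: (f v).
apply: (recursive_iteri (g := fun u => nth 0 u 0)) => //.
  exact: recursive_const.
exact: recursive_nth.
Qed.

Lemma recursive_sub k f g : recursive k f -> recursive k g ->
  recursive k (fun v => f v - g v).
Proof.
move=> rf rg; apply: (eq_recursive (f := fun v =>
    iteri (g v) (fun i s => (nth 0 [:: i, s & v] 1).-1) (f v))).
  by move=> v _ /=; elim: (g v) => [|m /= ->]; rewrite ?subn0 ?subnS.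
by apply: (recursive_iteri (g := fun u => (nth 0 u 1).-1)) => //;
  apply: recursive_pred; exact: recursive_nth.
Qed.

Lemma recursive_bigop (op : nat -> nat -> nat) (x0 : nat) k n F :
  (forall j f g, recursive j f -> recursive j g ->
     recursive j (fun v => op (f v) (g v))) ->
  recursive k n -> recursive k.+1 F ->
  recursive k (fun v => iteri (n v) (fun i s => op s (F (i :: v))) x0).
Proof.
move=> rop rn rF.
apply: (recursive_iteri (g := fun u =>
  op (nth 0 u 1) (F (nth 0 u 0 :: iter 2 behead u)))) => //.
  exact: recursive_const.
apply: rop; first exact: recursive_nth.
apply: (recursive_cons (gs := [:: (nth 0)^~ 0]) (j := 2) rF).
by split=> //; exact: recursive_nth.
Qed.

Lemma recursive_sum k n F : recursive k n -> recursive k.+1 F ->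
  recursive k (fun v => \sum_(i < n v) F (val i :: v)).
Proof.
move=> rn rF.
apply: eq_recursive (recursive_bigop (op := addn) 0 recursive_add rn rF) => v _.
by elim: (n v) => [|m /= ->]; rewrite ?big_ord0 ?big_ord_recr.
Qed.

Lemma recursive_mul k f g : recursive k f -> recursive k g ->
  recursive k (fun v => f v * g v).
Proof.
move=> rf rg; apply: eq_recursive
    (recursive_sum (F := fun u => f (behead u)) rg (recursive_behead 1 rf)).
by move=> v _ /=; rewrite sum_nat_const card_ord mulnC.
Qed.

Lemma recursive_prod k n F : recursive k n -> recursive k.+1 F ->
  recursive k (fun v => \prod_(i < n v) F (val i :: v)).
Proof.
move=> rn rF.
apply: eq_recursive (recursive_bigop (op := muln) 1 recursive_mul rn rF) => v _.
by elim: (n v) => [|m /= ->]; rewrite ?big_ord0 ?big_ord_recr.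
Qed.

Lemma recursive_max k n F : recursive k n -> recursive k.+1 F ->
  recursive k (fun v => \max_(i < n v) F (val i :: v)).
Proof.
move=> rn rF.
have rmax j f g : recursive j f -> recursive j g ->
    recursive j (fun v => maxn (f v) (g v)).
  move=> rf rg; apply: (eq_recursive (f := fun v => f v + (g v - f v))).
    by move=> v _; rewrite maxnE.
  by apply: recursive_add => //; exact: recursive_sub.
apply: eq_recursive (recursive_bigop (op := maxn) 0 rmax rn rF) => v _.
by elim: (n v) => [|m /= ->]; rewrite ?big_ord0 ?big_ord_recr.
Qed.

Lemma recursive_exp2 k f : recursive k f -> recursive k (fun v => 2 ^ f v).
Proof.
move=> rf.
apply: eq_recursive (recursive_prod (F := fun=> 2) rf (recursive_const _ _)).
by move=> v _; rewrite prod_nat_const card_ord.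
Qed.

Lemma recursive_leq k f g : recursive k f -> recursive k g ->
  recursive k (fun v => nat_of_bool (f v <= g v)).
Proof.
move=> rf rg; apply: (eq_recursive (f := fun v => 1 - (f v - g v))).
  by move=> v _; rewrite -subn_eq0; case: (f v - g v).
by apply: recursive_sub; [exact: recursive_const|exact: recursive_sub].
Qed.

Lemma recursive_andb k (f g : seq nat -> bool) : recursive k f -> recursive k g ->
  recursive k (fun v => nat_of_bool (f v && g v)).
Proof.
move=> rf rg; apply: (eq_recursive (f := fun v => f v * g v)).
  by move=> v _; rewrite mulnb.
exact: recursive_mul.
Qed.

Lemma recursive_negb k (f : seq nat -> bool) : recursive k f ->
  recursive k (fun v => nat_of_bool (~~ f v)).
Proof.
move=> rf; apply: (eq_recursive (f := fun v => 1 - f v)).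
  by move=> v _; case: (f v).
by apply: recursive_sub => //; exact: recursive_const.
Qed.

Lemma recursive_orb k (f g : seq nat -> bool) : recursive k f -> recursive k g ->
  recursive k (fun v => nat_of_bool (f v || g v)).
Proof.
move=> rf rg; apply: (eq_recursive (f := fun v => ~~ (~~ f v && ~~ g v))).
  by move=> v _; rewrite negb_and !negbK.
by apply: recursive_negb; apply: recursive_andb; exact: recursive_negb.
Qed.

Lemma recursive_eq k f g : recursive k f -> recursive k g ->
  recursive k (fun v => nat_of_bool (f v == g v)).
Proof.
move=> rf rg; apply: (eq_recursive (f := fun v => (f v <= g v) && (g v <= f v))).
  by move=> v _; rewrite eqn_leq.
by apply: recursive_andb; exact: recursive_leq.
Qed.

(** Quotients, word lengths and exponents of 2 are computed by counting the indices below them, up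
    to any sufficient bound. This takes the place of bounded search. *)
Lemma sum_ltn m n : \sum_(i < n) (i < m) = minn m n.
Proof.
elim: n => [|n IH]; first by rewrite big_ord0 minn0.
by rewrite big_ord_recr /= IH; lia.
Qed.

Lemma recursive_div k f g : recursive k f -> recursive k g ->
  (forall v, 0 < g v) -> recursive k (fun v => f v %/ g v).
Proof.
move=> rf rg g0.
apply: eq_recursive (recursive_sum (F := fun u =>
    nat_of_bool ((nth 0 u 0).+1 * g (behead u) <= f (behead u))) rf _) => [v _|].
  rewrite /=; transitivity (\sum_(i < f v) (i < f v %/ g v)).
    by apply: eq_bigr => i _; rewrite leq_divRL.
  by rewrite sum_ltn; apply/minn_idPl; exact: leq_div.
apply: recursive_leq; last exact: (recursive_behead 1).
apply: recursive_mul; last exact: (recursive_behead 1).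
by apply: recursive_succ; exact: recursive_nth.
Qed.

(** * Recursive enumerability of the graph of a program *)

(* [F (n :: v)] runs [c] on [v] with fuel [n]; the value [y.+1] means that the
   run ends with result [y], the value [0] that the fuel is exhausted. *)
Definition fueled (c : recfun) (k : nat) (F : seq nat -> nat) : Prop :=
  forall v, size v = k ->
    (forall n y, F (n :: v) = y.+1 -> reval c v y) /\
    (forall y, reval c v y -> exists n0, forall n, n0 <= n -> F (n :: v) = y.+1).

Lemma recursive_all_pos k (gs : seq (seq nat -> nat)) :
  all_recursive k gs ->
  recursive k (fun v => nat_of_bool (all (fun g => 0 < g v) gs)).
Proof.
elim: gs => [_|g gs IH /= [rg /IH rgs]]; first exact: recursive_const.
by apply: recursive_andb => //; apply: recursive_leq => //; exact: recursive_const.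
Qed.

Lemma all_recursive_map k (h : (seq nat -> nat) -> seq nat -> nat) gs :
  (forall g, recursive k g -> recursive k (h g)) ->
  all_recursive k gs -> all_recursive k (map h gs).
Proof. by move=> hr; elim: gs => //= g gs IH [/hr rg /IH rgs]. Qed.

Lemma eventually_all (I : finType) (Q : I -> nat -> Prop) :
  (forall i, exists n0, forall n, n0 <= n -> Q i n) ->
  exists n0, forall i n, n0 <= n -> Q i n.
Proof.
move=> /choice [N NQ]; exists (\max_i N i) => i n le; apply: NQ.
exact: leq_trans (leq_bigmax i) le.
Qed.

Lemma fueled_comp m f (g : 'I_m -> recfun) k F (G : 'I_m -> seq nat -> nat) :
  fueled f m F -> recursive m.+1 F ->
  (forall i, fueled (g i) k (G i)) -> (forall i, recursive k.+1 (G i)) ->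
  exists2 H, fueled (RComp f g) k H & recursive k.+1 H.
Proof.
move=> fF rF fG rG.
pose gs := [seq G i | i <- enum 'I_m].
have rgs : all_recursive k.+1 gs.
  by rewrite /gs; elim: (enum _) => //= i s IH; split.
(* The first factor keeps the result at 0 while some argument is still undefined; the predecessors
   undo the shift by one. *)
exists (fun v => [forall i, 0 < G i v] *
    F (nth 0 v 0 :: [tuple (G i v).-1 | i < m])).
  move=> v vk; split=> [n y|y [w [gw fw]]].
    case: forallP => //= pos; rewrite mul1n => Fy.
    exists [tuple (G i (n :: v)).-1 | i < m]; split.
      move=> i; rewrite tnth_mktuple; apply: (proj1 (fG i _ vk)).
      by rewrite prednK // pos.
    by have := proj1 (fF _ (size_tuple [tuple (G i (n :: v)).-1 | i < m])) n y Fy.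
  have [n1 H1] := eventually_all (fun i => proj2 (fG i _ vk) _ (gw i)).
  have [n2 H2] := proj2 (fF _ (size_tuple w)) _ fw.
  exists (maxn n1 n2) => n; rewrite geq_max => /andP[le1 le2].
  have -> : [forall i, 0 < G i (n :: v)] by apply/forallP => i; rewrite H1.
  rewrite mul1n [nth _ _ _]/=.
  suff -> : [tuple (G i (n :: v)).-1 | i < m] = w by exact: H2.
  by apply: eq_from_tnth => i; rewrite tnth_mktuple H1.
apply: (eq_recursive (f := fun v => all (fun g => 0 < g v) gs *
    F [seq g v | g <- (fun v => nth 0 v 0) :: [seq (fun v => (g v).-1) | g <- gs]])).
  move=> v _; congr (nat_of_bool _ * F _).
    rewrite /gs all_map; apply/allP/forallP => /= [H i|H i _]; last exact: H.
    by apply: H; rewrite mem_enum.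
  by rewrite /gs /= -!map_comp.
apply: recursive_mul; first exact: recursive_all_pos.
apply: recursive_comp; first by rewrite [size _]/= size_map (size_map G) size_enum_ord.
split; first exact: recursive_nth.
by apply: all_recursive_map rgs => h rh; exact: recursive_pred.
Qed.

Lemma fueled_prec k f g F G :
  fueled f k F -> recursive k.+1 F -> fueled g k.+2 G -> recursive k.+3 G ->
  exists2 H, fueled (RPrec f g) k.+1 H & recursive k.+2 H.
Proof.
move=> fF rF fG rG.
pose step u := (0 < nth 0 u 1) *
  G [:: nth 0 u 2, nth 0 u 0, (nth 0 u 1).-1 & iter 4 behead u].
(* A stage that runs out of fuel sets the accumulator to 0, and the factor [0 < s] keeps it
   there. *)
pose run n w h :=
  iteri h (fun i s => (0 < s) * G [:: n, i, s.-1 & w]) (F (n :: w)).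
exists (fun v => run (nth 0 v 0) (iter 2 behead v) (nth 0 v 1)).
  move=> [//|h w] [wk] /=; split=> [n y|y [s [f0 gs ->]]] /=.
    move=> Hy; exists (fun j => (run n w j).-1).
    (* Induction on [h - j]: the last stage is positive, and a positive stage forces the preceding
       one to be positive. *)
    have pos j : j <= h -> 0 < run n w j.
      move=> /subnKC; move: (h - j) => d; elim: d j => [|d IH] j jd.
        by rewrite -[j]addn0 jd Hy.
      have /= := IH j.+1; rewrite addSnnS => /(_ jd).
      by rewrite -/(run n w j) muln_gt0 lt0b => /andP[].
    split; last by rewrite Hy.
    - by apply: (proj1 (fF w wk) n); rewrite prednK ?(pos 0).
    - move=> i ih; apply: (proj1 (fG [:: i, (run n w i).-1 & w] _) n).
        by rewrite /= wk.
      rewrite prednK ?pos //= -/(run n w i).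
      by rewrite (pos i (ltnW ih)) mul1n.
  elim: h gs => [_|h IH gs].
    by have [n0 H] := proj2 (fF w wk) _ f0; exists n0 => n /H.
  have [n1 H1] := IH (fun i ih => gs i (ltnW ih)).
  have sz : size [:: h, s h & w] = k.+2 by rewrite /= wk.
  have [n2 H2] := proj2 (fG _ sz) _ (gs h (ltnSn h)).
  exists (maxn n1 n2) => n; rewrite geq_max => /andP[le1 le2].
  by rewrite /run /= -/(run n w h) H1 //= mul1n H2.
apply: (eq_recursive (f := fun v => iteri (nth 0 v 1)
    (fun i s => step [:: i, s & v]) (F (nth 0 v 0 :: iter 2 behead v)))).
  by move=> [//|n [//|h w]] _.
apply: recursive_iteri; first exact: recursive_nth.
  apply: (recursive_cons (gs := [:: (nth 0)^~ 0]) (j := 2) rF).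
  by split=> //; exact: recursive_nth.
apply: recursive_mul.
  by apply: recursive_leq; [exact: recursive_const|exact: recursive_nth].
apply: (recursive_cons (gs := [:: (nth 0)^~ 2; (nth 0)^~ 0;
  fun u => (nth 0 u 1).-1]) (j := 4) rG).
by do !split; try apply: recursive_pred; exact: recursive_nth.
Qed.

Lemma fueled_mu k f F : fueled f k.+1 F -> recursive k.+2 F ->
  exists2 H, fueled (RMu f) k H & recursive k.+1 H.
Proof.
move=> fF rF.
(* In shifted values, 1 is the result 0 and anything above 1 is a positive result. So [found] says
   that [y] is the minimum sought and that all runs up to [y] end within the fuel [n]. *)
pose found n y v :=
  (F [:: n, y & v] == 1) && (\sum_(i < y) (F [:: n, val i & v] <= 1) == 0).
have foundP n y v : reflect
    (F [:: n, y & v] = 1 /\ forall i, i < y -> 1 < F [:: n, i & v])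
    (found n y v).
  rewrite /found sum_nat_eq0; apply: (iffP andP) => [[/eqP-> /forallP H]|[-> H]].
    by split=> // i iy; have := H (Ordinal iy); rewrite /= eqb0 -ltnNge.
  by split=> //; apply/forallP => i /=; rewrite eqb0 -ltnNge H.
(* The fuel also bounds the search. At most one [y] is found, so the maximum is its shifted value,
   or 0. *)
exists (fun v => \max_(y < nth 0 v 0) (y.+1 * found (nth 0 v 0) y (behead v))).
  move=> v vk; split=> [n y|y [/= f0 fi]] /=.
    move=> maxy; have n0 : 0 < #|'I_n|.
      by rewrite card_ord; case: n maxy => //; rewrite big_ord0.
    have [i] := eq_bigmax (fun y : 'I_n => y.+1 * found n y v) n0.
    rewrite maxy; case: foundP; rewrite ?muln0 // muln1 => -[Fi1 Fi] [->].
    split; first exact: (proj1 (fF (val i :: v) (congr1 S vk)) n).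
    move=> j ji; exists (F [:: n, j & v]).-2.
    apply: (proj1 (fF (j :: v) (congr1 S vk)) n).
    by have := Fi _ ji; case: (F _) => [|[]].
  have [n0 H0] := proj2 (fF (y :: v) (congr1 S vk)) _ f0.
  have [z fz] := choice (fun i : 'I_y => fi i (ltn_ord i)).
  have [n1 H1] := eventually_all
    (fun i : 'I_y => proj2 (fF (val i :: v) (congr1 S vk)) _ (fz i)).
  exists (maxn y.+1 (maxn n0 n1)) => n; rewrite !geq_max => /and3P[yn n0n n1n].
  have fy : found n y v.
    apply/foundP; split=> [|i iy]; first exact: H0.
    by rewrite (H1 (Ordinal iy)).
  have uniq_found y' : found n y' v -> y' = y.
    move/foundP: fy => [F1 Fy] /foundP[F1' Fy'].
    case: (ltngtP y' y) => // lt; [have := Fy _ lt|have := Fy' _ lt].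
      by rewrite F1'.
    by rewrite F1.
  apply/eqP; rewrite eqn_leq; apply/andP; split.
    apply/bigmax_leqP => i _; case: (boolP (found n i v)) => [/uniq_found ->|_].
      by rewrite muln1.
    by rewrite muln0.
  apply: (bigmax_sup (Ordinal yn)) => //=.
  by rewrite fy muln1.
pose E u := (nth 0 u 0).+1 * found (nth 0 u 1) (nth 0 u 0) (iter 2 behead u).
apply: (eq_recursive (f := fun v => \max_(y < nth 0 v 0) E (val y :: v))) => //.
apply: recursive_max; first exact: recursive_nth.
apply: recursive_mul; first by apply: recursive_succ; exact: recursive_nth.
apply: recursive_andb.
  apply: recursive_eq; last exact: recursive_const.
  apply: (recursive_cons (gs := [:: (nth 0)^~ 1; (nth 0)^~ 0]) (j := 2) rF).
  by do !split; exact: recursive_nth.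
apply: recursive_eq; last exact: recursive_const.
apply: (recursive_sum (F := fun u => nat_of_bool
  (F [:: nth 0 u 2, nth 0 u 0 & iter 3 behead u] <= 1))).
  exact: recursive_nth.
apply: recursive_leq; last exact: recursive_const.
apply: (recursive_cons (gs := [:: (nth 0)^~ 2; (nth 0)^~ 0]) (j := 3) rF).
by do !split; exact: recursive_nth.
Qed.

(** A form of Kleene's normal form theorem. The arity varies in the induction, since composition,
    recursion and minimization run their subprograms on lists of other lengths. *)
Lemma fueled_exists c k : exists2 F, fueled c k F & recursive k.+1 F.
Proof.
elim: c k => [||i|m f IHf g IHg|f IHf g IHg|f IHf] k.
- exists (fun=> 1); last exact: recursive_const.
  by move=> v _; split=> [n y [<-]|y /= ->] //; exists 0.
- exists (fun v => (nth 0 v 1).+2).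
    by move=> v _; rewrite /= nth0; split=> [n y [<-]|y /= ->] //; exists 0.
  by do 2!apply: recursive_succ; exact: recursive_nth.
- exists (fun v => (nth 0 v i.+1).+1).
    by move=> v _; split=> [n y [<-]|y /= ->] //; exists 0.
  by apply: recursive_succ; exact: recursive_nth.
- have [F fF rF] := IHf m.
  have /choice[G GP] i : exists G, fueled (g i) k G /\ recursive k.+1 G.
    by have [G fG rG] := IHg i k; exists G.
  exact: fueled_comp fF rF (fun i => proj1 (GP i)) (fun i => proj2 (GP i)).
- case: k => [|k].
    (* On the empty list the recursion argument reads as 0, so only the base program is run. *)
    have [F fF rF] := IHf 0; exists F => // v /size0nil ->.
    split=> [n y Fy|y /= [s [fs _ ->]]].
      by exists (fun=> y); split=> //; exact: (proj1 (fF [::] erefl) n).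
    exact: (proj2 (fF [::] erefl)).
  have [F fF rF] := IHf k; have [G fG rG] := IHg k.+2.
  exact: fueled_prec fF rF fG rG.
- have [F fF rF] := IHf k.+1; exact: fueled_mu fF rF.
Qed.

(** * Arithmetic of word codes and enumerable sets *)

Lemma word_code_inj : injective word_code.
Proof.
elim=> [|b x IH] [|c y] //= [] E.
have bc : b = c by lia.
by rewrite bc; congr cons; apply: IH; move: E; rewrite bc; lia.
Qed.

Lemma word_code_onto n : exists x, word_code x = n.
Proof.
elim/ltn_ind: n => -[|n] IH; first by exists [::].
have [|x xE] := IH n./2; first lia.
by exists (odd n :: x); rewrite /= xE; lia.
Qed.

(** The inverse is obtained by choice and is never programmed: what is needed about decoded words is
    reduced to arithmetic on their codes. *)
Definition word_of : nat -> word := projT1 (choice word_code_onto).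

Lemma word_ofK : cancel word_of word_code.
Proof. exact: (projT2 (choice word_code_onto)). Qed.

Lemma word_codeK : cancel word_code word_of.
Proof. by move=> x; apply: word_code_inj; rewrite word_ofK. Qed.

Lemma word_code_cat x y :
  word_code (x ++ y) = word_code x + 2 ^ size x * word_code y.
Proof. by elim: x => [|b x IH] /=; rewrite ?mul1n // IH expnS; lia. Qed.

(** Equivalently, the codes of the words of length n fill the interval from 2^n - 1 to 2^(n+1) - 2;
    the length is thus the integer part of a binary logarithm. *)
Lemma word_code_bounds x : 2 ^ size x <= (word_code x).+1 < 2 ^ (size x).+1.
Proof.
elim: x => //= b x /andP[le lt]; rewrite expnS [2 ^ _.+2]expnS; apply/andP.
by split; lia.
Qed.

Lemma size_word_of i : size (word_of i) = \sum_(k < i) (2 ^ k.+1 <= i.+1).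
Proof.
have := word_code_bounds (word_of i); rewrite word_ofK => /andP[le lt].
transitivity (\sum_(k < i) (k < size (word_of i))).
  rewrite sum_ltn; symmetry; apply/minn_idPl.
  by rewrite -ltnS; apply: leq_trans le; exact: ltn_expl.
apply: eq_bigr => k _; congr nat_of_bool; apply/idP/idP => H.
  by apply: leq_trans le; rewrite leq_exp2l.
by rewrite -ltnS -(ltn_exp2l _ _ (ltnSn 1)); exact: leq_ltn_trans lt.
Qed.

(** Appending a word to [x] adds a multiple of [2 ^ size x] to the code, and every multiple arises
    in this way, [word_code] being onto. *)
Lemma prefix_word_code x y : prefix x y =
  (word_code x <= word_code y) && (2 ^ size x %| word_code y - word_code x).
Proof.
apply/prefixP/andP => [[z ->]|[le /dvdnP[z zE]]].
  by rewrite word_code_cat leq_addr addKn dvdn_mulr.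
exists (word_of z); apply: word_code_inj.
by rewrite word_code_cat word_ofK mulnC -zE subnKC.
Qed.

Lemma recursive_size k f : recursive k f ->
  recursive k (fun v => size (word_of (f v))).
Proof.
move=> rf; apply: eq_recursive (recursive_sum (F := fun u =>
  nat_of_bool (2 ^ (nth 0 u 0).+1 <= (f (behead u)).+1)) rf _) => [v _|].
  by rewrite size_word_of.
apply: recursive_leq.
  by apply: recursive_exp2; apply: recursive_succ; exact: recursive_nth.
by apply: recursive_succ; exact: (recursive_behead 1).
Qed.

Lemma recursive_dvd k f g : recursive k f -> recursive k g ->
  (forall v, 0 < f v) -> recursive k (fun v => nat_of_bool (f v %| g v)).
Proof.
move=> rf rg f0; apply: (eq_recursive (f := fun v => g v %/ f v * f v == g v)).
  by move=> v _; rewrite dvdn_eq.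
by apply: recursive_eq => //; apply: recursive_mul => //; exact: recursive_div.
Qed.

Lemma recursive_prefix k f g : recursive k f -> recursive k g ->
  recursive k (fun v => nat_of_bool (prefix (word_of (f v)) (word_of (g v)))).
Proof.
move=> rf rg; apply: (eq_recursive (f := fun v =>
    (f v <= g v) && (2 ^ size (word_of (f v)) %| g v - f v))).
  by move=> v _; rewrite prefix_word_code !word_ofK.
apply: recursive_andb; first exact: recursive_leq.
apply: recursive_dvd; last by move=> v; rewrite expn_gt0.
  by apply: recursive_exp2; exact: recursive_size.
exact: recursive_sub.
Qed.

(* Every positive number is uniquely [2 ^ a * b.*2.+1]; this codes the pair
   [(a, b)]. *)
Definition pair_code a b : nat := (2 ^ a * b.*2.+1).-1.
Definition pair_fst n : nat := \sum_(i < n.+1) (2 ^ i.+1 %| n.+1).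
Definition pair_snd n : nat := n.+1 %/ 2 ^ (pair_fst n).+1.

Lemma pair_codeS a b : (pair_code a b).+1 = 2 ^ a * b.*2.+1.
Proof. by rewrite /pair_code prednK // muln_gt0 expn_gt0. Qed.

Lemma pair_fstK a b : pair_fst (pair_code a b) = a.
Proof.
rewrite /pair_fst pair_codeS.
transitivity (\sum_(i < 2 ^ a * b.*2.+1) (i < a)).
  apply: eq_bigr => i _; rewrite pfactor_dvdn ?muln_gt0 ?expn_gt0 //.
  rewrite lognM ?expn_gt0 // pfactorK // lognE /=.
  by rewrite dvdn2 /= odd_double /= addn0.
rewrite sum_ltn; apply/minn_idPl/ltnW/(leq_trans (ltn_expl a (ltnSn 1))).
exact: leq_pmulr.
Qed.

(** The division by [2 ^ a.+1] yields b + 1/2, which truncates to [b]. *)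
Lemma pair_sndK a b : pair_snd (pair_code a b) = b.
Proof.
rewrite /pair_snd pair_fstK pair_codeS expnS mulnC divnMr ?expn_gt0 //; lia.
Qed.

(** Every number codes an infinite sequence of entries. No length is stored, because the number of
    entries to read is known wherever a code is used. *)
Definition arg n j : nat := pair_fst (iter j pair_snd n).

Lemma arg_onto l : exists n, forall j, j < size l -> arg n j = nth 0 l j.
Proof.
elim: l => [|a l [n nE]]; first by exists 0.
exists (pair_code a n) => -[_|j jl]; first exact: pair_fstK.
by rewrite /arg iterSr pair_sndK; exact: nE.
Qed.

Lemma recursive_pair_fst k f : recursive k f -> recursive k (fun v => pair_fst (f v)).
Proof.
move=> rf; apply: (recursive_sum (n := fun v => (f v).+1) (F := fun u =>
  nat_of_bool (2 ^ (nth 0 u 0).+1 %| (f (behead u)).+1))).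
  exact: recursive_succ.
apply: recursive_dvd; last by move=> v; rewrite expn_gt0.
  by apply: recursive_exp2; apply: recursive_succ; exact: recursive_nth.
by apply: recursive_succ; exact: (recursive_behead 1).
Qed.

Lemma recursive_arg k f j : recursive k f -> recursive k (fun v => arg (f v) j).
Proof.
move=> rf; apply: recursive_pair_fst; elim: j => //= j IH.
apply: recursive_div; last by move=> v; rewrite expn_gt0.
  exact: recursive_succ.
by apply: recursive_exp2; apply: recursive_succ; exact: recursive_pair_fst.
Qed.

Lemma computable1P f : computable (fun n => [:: n]) f <->
  recursive 1 (fun v => f (nth 0 v 0)).
Proof.
split=> -[c cf]; exists c; last by move=> n; exact: (cf [:: n]).
by move=> [|n [|]] // _; exact: cf.
Qed.

Lemma computable_word2P f :
  computable (fun z : word * nat => [:: word_code z.1; z.2]) f <->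
  recursive 2 (fun v => f (word_of (nth 0 v 0), nth 0 v 1)).
Proof.
split=> -[c cf]; exists c.
  by move=> [|n [|m [|]]] // _ /=; have := cf (word_of n, m); rewrite word_ofK.
by move=> [x m]; have := cf [:: word_code x; m] erefl; rewrite /= word_codeK.
Qed.

Definition rat_of (a b d : nat) : rat := ((a%:R - b%:R) / d.+1%:R)%R.

(** Step [n] decodes [n] as a [k]-tuple and outputs its word and its rational if [E] accepts it;
    every [k]-tuple has a code. The entries after the first four are existential witnesses. *)
Lemma enumerable_sigma1 k (E : seq nat -> bool) (W : set (word * rat)) :
  recursive k E ->
  (forall x r, W (x, r) <-> exists v, [/\ size v = k, E v,
     word_of (nth 0 v 0) = x & rat_of (nth 0 v 1) (nth 0 v 2) (nth 0 v 3) = r]) ->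
  enumerable W.
Proof.
move=> rE WE; pose dec n := mkseq (arg n) k.
have rdec g : recursive k g -> recursive 1 (fun v => g (dec (nth 0 v 0))).
  move=> rg; apply: (eq_recursive (f := fun v => g
      [seq h v | h <- [seq (fun v => arg (nth 0 v 0) j) | j <- iota 0 k]])).
    by move=> v _; rewrite -map_comp.
  apply: recursive_comp; first by rewrite size_map size_iota.
  elim: (iota 0 k) => //= j s IH; split=> //.
  by apply: recursive_arg; exact: recursive_nth.
have rdec_nth i : recursive 1 (fun v => nth 0 (dec (nth 0 v 0)) i).
  by apply: (rdec (fun w => nth 0 w i)); exact: recursive_nth.
exists (fun n => E (dec n)), (fun n => word_of (nth 0 (dec n) 0)),
  (fun n => rat_of (nth 0 (dec n) 1) (nth 0 (dec n) 2) (nth 0 (dec n) 3)); split.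
- by apply/computable1P; exact: (rdec (fun w => nat_of_bool (E w))).
- apply/computable1P; apply: (eq_recursive (f := fun v => nth 0 (dec (nth 0 v 0)) 0)).
    by move=> v _; rewrite word_ofK.
  exact: rdec_nth.
- exists (fun n => nth 0 (dec n) 1), (fun n => nth 0 (dec n) 2),
    (fun n => nth 0 (dec n) 3).
  by split=> //; apply/computable1P; exact: rdec_nth.
- move=> x r; rewrite WE; split=> [[v [vk Ev xE rE']]|[n [En xE rE']]].
    have [n nE] := arg_onto v; exists n.
    suff -> : dec n = v by [].
    apply: (@eq_from_nth _ 0); rewrite size_mkseq // => i ik.
    by rewrite nth_mkseq // nE // vk.
  by exists (dec n); rewrite size_mkseq.
Qed.

(** [recursive_sum] handles initial segments of the natural numbers, hence the shift by the least
    code of a word of length [n]. *)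
Lemma sum_words (V : nmodType) n (f : word -> V) :
  (\sum_(y : n.-tuple bool) f y = \sum_(i < 2 ^ n) f (word_of (i + (2 ^ n).-1)))%R.
Proof.
pose s := [seq word_of (i + (2 ^ n).-1) | i <- iota 0 (2 ^ n)].
have n0 : 0 < 2 ^ n by rewrite expn_gt0.
transitivity (\sum_(y <- s) f y)%R; last first.
  by rewrite big_map -{1}[2 ^ n]subn0 -/(index_iota 0 (2 ^ n)) big_mkord.
rewrite -(big_map (fun y : n.-tuple bool => tval y) predT f).
apply: perm_big; apply: uniq_perm.
- by rewrite map_inj_uniq ?index_enum_uniq //; exact: val_inj.
- rewrite map_inj_uniq ?iota_uniq // => i j /(congr1 word_code).
  by rewrite !word_ofK => /addIn.
- move=> y; have /andP[le lt] := word_code_bounds y.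
  apply/mapP/mapP => [[t _ ->]|[i]].
    exists (word_code t - (2 ^ n).-1).
      rewrite mem_iota /=; have := word_code_bounds t.
      by rewrite size_tuple expnS; move: (2 ^ n) n0 (word_code t) => p ? q; lia.
    rewrite subnK ?word_codeK //; have := word_code_bounds t.
    by rewrite size_tuple; move: (2 ^ n) => p; lia.
  rewrite mem_iota add0n => /andP[_ ilt] yE.
  have yn : size y == n.
    move: le lt; rewrite yE word_ofK -yE => le lt.
    have : 2 ^ size y < 2 ^ n.+1 /\ 2 ^ n < 2 ^ (size y).+1.
      move: le lt; rewrite !expnS; move: (2 ^ n) ilt n0 (2 ^ size y) => p ? ? q.
      by lia.
    by move=> []; rewrite !ltn_exp2l // !ltnS eqn_leq => -> ->.
  by exists (Tuple yn) => //; rewrite mem_index_enum.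
Qed.

Import Order.TTheory GRing.Theory Num.Theory.
Local Open Scope ring_scope.

(** * Integration over cylinders *)

Lemma cylinderP x (w : nat -> bool) : cylinder x w <-> mkseq w (size x) = x.
Proof. by []. Qed.

Lemma prefix_mkseq (w : nat -> bool) m n : (m <= n)%N ->
  prefix (mkseq w m) (mkseq w n).
Proof.
move=> mn; rewrite prefixE size_mkseq /mkseq -map_take take_iota.
by rewrite (minn_idPl mn).
Qed.

Lemma cylinder_prefix x (w : nat -> bool) n : (size x <= n)%N ->
  cylinder x w <-> prefix x (mkseq w n).
Proof.
move=> xn; have /prefixP[z zE] := prefix_mkseq w xn; split=> [<-|].
  exact: prefix_mkseq.
by rewrite prefixE zE take_size_cat ?size_mkseq // => /eqP.
Qed.

Lemma measurable_cylinder x : measurable (cylinder x : set Omega).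
Proof. by apply: sub_sigma_algebra; exists x. Qed.

Lemma measurable_bigcup_cylinder (S : set word) :
  measurable (\bigcup_(x in S) cylinder x : set Omega).
Proof.
have -> : \bigcup_(x in S) cylinder x =
    \bigcup_(i in [set i | S (word_of i)]) cylinder (word_of i).
  apply/seteqP; split=> w [x Sx xw]; last by exists (word_of x).
  by exists (word_code x); rewrite /= word_codeK.
by apply: bigcup_measurable => i _; exact: measurable_cylinder.
Qed.

Lemma measurable_fun_mkseq (R : realType) (f : word -> \bar R) n (D : set Omega) :
  measurable_fun D (fun w : Omega => f (mkseq w n)).
Proof.
apply: (@measurable_funS _ _ _ _ setT) => //.
move=> _ B _; rewrite setTI.
have -> : (fun w : Omega => f (mkseq w n)) @^-1` B =
    \bigcup_(x in [set x | size x = n /\ B (f x)]) cylinder x.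
  apply/seteqP; split=> w.
    move=> Bw; exists (mkseq w n); first by rewrite /= size_mkseq.
    by rewrite /cylinder /= size_mkseq.
  by move=> [x [<- Bx] /cylinderP xw]; rewrite /preimage /= xw.
exact: measurable_bigcup_cylinder.
Qed.

Section measure.
Variables (R : realType) (P : probability Omega R).

Lemma wmeasureE x : (wmeasure P x)%:E = P (cylinder x).
Proof. by rewrite fineK // fin_num_measure //; exact: measurable_cylinder. Qed.

Lemma integral_mkseq x n (f : word -> \bar R) : (size x <= n)%N ->
  (forall y, (0 <= f y)%E) ->
  (\int[P]_(w in cylinder x) f (mkseq w n) =
   \sum_(y : n.-tuple bool | prefix x y) (wmeasure P y)%:E * f y)%E.
Proof.
move=> xn f0.
pose s := [seq y : n.-tuple bool <- index_enum _ | prefix x y].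
have xE : cylinder x = \big[setU/set0]_(y <- s) cylinder (tval y).
  rewrite -bigcup_seq; apply/seteqP; split=> w.
    move=> /(cylinder_prefix w xn) xw.
    have sz : size (mkseq w n) == n by rewrite size_mkseq.
    exists (Tuple sz) => /=.
      by rewrite mem_filter mem_index_enum xw.
    by rewrite /cylinder /= size_mkseq.
  move=> [y]; rewrite /= mem_filter => /andP[xy _] /cylinderP.
  by rewrite size_tuple => yw; apply/(cylinder_prefix w xn); rewrite yw.
rewrite xE ge0_integral_bigsetU //=; first last.
- exact: measurable_fun_mkseq.
- apply/trivIsetP => y z _ _ yz; apply/eqP/negPn/negP => /set0P[w []].
  move=> /cylinderP; rewrite size_tuple => yw /cylinderP; rewrite size_tuple => zw.
  by move/eqP: yz; apply; apply: val_inj; exact: etrans (esym yw) zw.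
- exact/filter_uniq/index_enum_uniq.
- by move=> y; exact: measurable_cylinder.
rewrite big_filter; apply: eq_bigr => y _.
rewrite muleC wmeasureE -integral_cst; last exact: measurable_cylinder.
apply: eq_integral => w; rewrite inE => /cylinderP.
by rewrite size_tuple => ->.
Qed.

Lemma sum_wmeasure_prefix x n : (size x <= n)%N ->
  \sum_(y : n.-tuple bool | prefix x y) wmeasure P y = wmeasure P x.
Proof.
move=> xn; apply: EFin_inj; rewrite -sumEFin wmeasureE.
rewrite -[RHS]mul1e -integral_cst; last exact: measurable_cylinder.
rewrite (integral_mkseq (f := fun=> 1%E) xn) //.
by apply: eq_bigr => y _; rewrite mule1.
Qed.

Section sup_integral.
Variables (F : nat -> word -> \bar R) (t : Omega -> \bar R).
Hypothesis F0 : forall n y, (0 <= F n y)%E.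
Hypothesis F_nd : forall w n, (F n (mkseq w n) <= F n.+1 (mkseq w n.+1))%E.
Hypothesis tE : forall w, t w = ereal_sup (range (fun n => F n (mkseq w n))).

Let F_homo w : nondecreasing_seq (fun n => F n (mkseq w n)).
Proof. by apply/nondecreasing_seqP => n; exact: F_nd. Qed.

Lemma measurable_fun_sup (D : set Omega) : measurable_fun D t.
Proof.
apply: (@measurable_realfun.emeasurable_fun_cvg _ _ _ _
  (fun n (w : Omega) => F n (mkseq w n))) => [m|w _].
  exact: measurable_fun_mkseq.
by rewrite tE; exact: ereal_nondecreasing_cvgn.
Qed.

(** Monotone convergence in the form needed for enumeration: a strict lower bound of the integral is
    witnessed by a stage, where the integral is a finite sum. The stage is at least [size x], so
    that the cylinder of [x] splits into cylinders of length [n]. *)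
Lemma lt_integral_sup x r :
  (r < \int[P]_(w in cylinder x) t w)%E <->
  exists2 n, (size x <= n)%N &
    (r < \sum_(y : n.-tuple bool | prefix x y) (wmeasure P y)%:E * F n y)%E.
Proof.
have mx := measurable_cylinder x.
have mF n : measurable_fun (cylinder x : set Omega) (fun w : Omega => F n (mkseq w n)).
  exact: measurable_fun_mkseq.
pose I n := (\int[P]_(w in cylinder x) F n (mkseq w n))%E.
have I_nd : nondecreasing_seq I.
  move=> m n mn; apply: ge0_le_integral => // w _; exact: F_homo.
have -> : (\int[P]_(w in cylinder x) t w = ereal_sup (range I))%E.
  transitivity (\int[P]_(w in cylinder x) limn (fun n => F n (mkseq w n)))%E.
    apply: eq_integral => w _; rewrite tE; apply/esym/cvg_lim => //.
    exact: ereal_nondecreasing_cvgn.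
  rewrite (monotone_convergence P mx mF) //.
  by apply/cvg_lim => //; exact: ereal_nondecreasing_cvgn.
split=> [/ereal_sup_gtP[_ [n _ <-] rI]|[n xn rn]].
  exists (maxn n (size x)); first exact: leq_maxr.
  rewrite -integral_mkseq ?leq_maxr //.
  by apply: lt_le_trans rI _; apply: I_nd; exact: leq_maxl.
apply/ereal_sup_gtP; exists (I n); first by exists n.
by rewrite /I integral_mkseq.
Qed.

End sup_integral.
End measure.

(** * Effective approximations *)

Lemma ratr_rat_of (R : realType) a b d :
  ratr (rat_of a b d) = (a%:R - b%:R) / d.+1%:R :> R.
Proof. by rewrite /rat_of fmorph_div rmorphB !rmorph_nat. Qed.

Lemma natr_divn_bounds (R : realFieldType) m d :
  (m %/ d.+1)%:R <= (m%:R / d.+1%:R : R) < (m %/ d.+1)%:R + 1.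
Proof.
rewrite ler_pdivlMr ?ltr0n // ltr_pdivrMr ?ltr0n // natr1 -!natrM ler_nat ltr_nat.
by rewrite leq_trunc_div -ltn_divLR // ltnSn.
Qed.

Lemma natrB_trunc (R : realDomainType) a b :
  (a - b)%:R = Num.max 0 (a%:R - b%:R) :> R.
Proof.
case: (leqP b a) => ab; first by rewrite natrB // max_r // subr_ge0 ler_nat.
rewrite (eqP (ltnW ab : (a - b)%N == 0)) max_l // subr_le0 ler_nat; exact: ltnW.
Qed.

Lemma half_pow_lt (R : realType) (e : R) : 0 < e ->
  exists n0, forall n, (n0 <= n)%N -> 2 ^- n < e.
Proof.
move=> e0; exists (Num.truncn e^-1).+1 => n le.
rewrite invf_plt ?posrE ?exprn_gt0 //.
apply: lt_le_trans (truncnS_gt _) _; rewrite -natrX ler_nat.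
exact: leq_trans le (ltnW (ltn_expl _ _)).
Qed.

Lemma recursive_computable1 k (f : nat -> nat) g :
  computable (fun n => [:: n]) f -> recursive k g -> recursive k (fun v => f (g v)).
Proof. by move=> /computable1P; exact: recursive1. Qed.

Lemma wmeasure_approx (R : realType) (P : probability Omega R) :
  computable_measure P -> exists L : word -> nat -> nat,
    recursive 2 (fun v => L (word_of (nth 0%N v 0)) (nth 0%N v 1)) /\
    forall y m, (L y m)%:R / 2 ^+ m <= wmeasure P y <= (L y m + 3)%:R / 2 ^+ m.
Proof.
move=> [q [[a [b [d [/computable_word2P ra /computable_word2P rb
  /computable_word2P rd qE]]]] Pq]].
(* In units of 2^-m, the given approximation errs by at most 1 and rounding down loses less than 1.
   The predecessor makes the result a lower bound and costs at most 1 more, whence the 3 in the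
   upper bound. *)
exists (fun y m => ((a (y, m) - b (y, m)) * 2 ^ m %/ (d (y, m)).+1).-1)%N.
split.
  apply: recursive_pred; apply: recursive_div => //; last exact: recursive_succ.
  apply: recursive_mul; first exact: recursive_sub.
  by apply: recursive_exp2; exact: recursive_nth.
move=> y m; have := Pq y m; rewrite qE -/(rat_of _ _ _) ratr_rat_of.
move: (a _) (b _) (d _) => {ra rb rd Pq qE a b d} a b d.
have P0 : 0 <= wmeasure P y by rewrite -lee_fin wmeasureE.
have t0 : 0 < 2 ^+ m :> R by rewrite exprn_gt0.
rewrite ler_pdivrMr // ler_pdivlMr //.
set z := (_ * 2 ^ m)%N; have /andP[le lt] := natr_divn_bounds R z d.
set c := (z %/ d.+1)%N in le lt *.
have zE : z%:R / d.+1%:R = Num.max 0 ((a%:R - b%:R) / d.+1%:R) * 2 ^+ m :> R.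
  by rewrite /z natrM natrX natrB_trunc mulrAC maxr_pMl ?mul0r // invr_ge0 ler0n.
rewrite {}zE in le lt.
move: ((a%:R - b%:R) / _) le lt => r le lt; rewrite ler_norml => /andP[r1 r2].
have s0 : 2 ^- m * 2 ^+ m = 1 :> R by rewrite mulVf // gt_eqF.
have Pm0 : 0 <= wmeasure P y * 2 ^+ m by rewrite mulr_ge0 // ltW.
have {}r1 : r * 2 ^+ m <= wmeasure P y * 2 ^+ m + 1 by nra.
have {}r2 : wmeasure P y * 2 ^+ m <= r * 2 ^+ m + 1 by nra.
move: le lt; rewrite !(maxr_pMl _ _ (ltW t0)) !mul0r.
have cE : (c.-1)%:R = Num.max 0 (c%:R - 1%:R) :> R by rewrite -natrB_trunc subn1.
rewrite natrD cE; move: (wmeasure P y * _) (r * _) (c%:R) Pm0 r1 r2.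
by move=> p s c' ? ? ?; rewrite /Num.max; do 2!case: ifPn; lra.
Qed.

Lemma rat_between (R : realType) (s : R) (z : \bar R) : (s%:E < z)%E ->
  exists2 r : rat, s < ratr r & ((ratr r)%:E < z)%E.
Proof.
case: z => [z| |] //; rewrite ?lte_fin => sz.
  have [r] := rat_in_itvoo sz.
  by rewrite in_itv /= => /andP[sr rz]; exists r => //; rewrite lte_fin.
have s1 : s < s + 1 by rewrite ltrDl.
have [r] := rat_in_itvoo s1.
by rewrite in_itv /= => /andP[sr _]; exists r => //; rewrite ltry.
Qed.

(** Consider the pairs (u, r) listed before step [n] with u a prefix of [y]. Then [B n y / 2 ^ n] is
    the largest of these r rounded down to a multiple of 2^-n, with 0 for negative r and for an
    empty list. *)
Lemma lower_semicomputable_stages (R : realType) (t : Omega -> \bar R) :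
  (forall w, (0 <= t w)%E) -> lower_semicomputable_Omega t ->
  exists B : nat -> word -> nat, [/\
    recursive 2 (fun v => B (nth 0 v 0) (word_of (nth 0 v 1)))%N,
    forall w n, (B n (mkseq w n))%:R / 2 ^+ n <=
      (B n.+1 (mkseq w n.+1))%:R / 2 ^+ n.+1 :> R
  & forall w, t w = ereal_sup (range (fun n => ((B n (mkseq w n))%:R / 2 ^+ n)%:E))].
Proof.
move=> t0 [W [e [u [q [/computable1P re ru [a [b [d [ra rb rd qE]]]] WE]]]] tW].
pose v n k := ((a k - b k) * 2 ^ n %/ (d k).+1)%N.
pose B n y := (\max_(k < n) ((e k && prefix (u k) y) * v n k))%N.
have B_gt0 n y : (0 < B n y)%N ->
    exists k, [/\ (k < n)%N, e k, prefix (u k) y & B n y = v n k].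
  move=> B0; have n0 : (0 < #|'I_n|)%N.
    by rewrite card_ord; case: n B0 => //; rewrite /B big_ord0.
  have [k kE] := bigop.eq_bigmax (fun k : 'I_n => (e k && prefix (u k) y) * v n k)%N n0.
  move: B0; rewrite /B kE; case: (boolP (e k && _)) => // /andP[ek uk].
  by rewrite mul1n => _; exists k.
have B_ge n y k : (k < n)%N -> e k -> prefix (u k) y -> (v n k <= B n y)%N.
  move=> kn ek uk; apply: (bigop.bigmax_sup (Ordinal kn)) => //=.
  by rewrite ek uk mul1n.
exists B; split.
- apply: (recursive_max (F := fun u0 => (e (nth 0 u0 0) &&
      prefix (u (nth 0 u0 0)) (word_of (nth 0 u0 2))) *
      v (nth 0 u0 1) (nth 0 u0 0)))%N; first exact: recursive_nth.
  apply: recursive_mul.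
    apply: recursive_andb.
      by apply: (recursive1 (f := fun k => nat_of_bool (e k))) => //; exact: recursive_nth.
    apply: (eq_recursive (f := fun u0 => nat_of_bool (prefix
        (word_of (word_code (u (nth 0 u0 0)))) (word_of (nth 0 u0 2))))%N).
      by move=> ? _; rewrite word_codeK.
    apply: recursive_prefix; last exact: recursive_nth.
    by apply: (recursive_computable1 ru); exact: recursive_nth.
  apply: recursive_div => //.
    apply: recursive_mul; last by apply: recursive_exp2; exact: recursive_nth.
    by apply: recursive_sub; [apply: (recursive_computable1 ra)|
      apply: (recursive_computable1 rb)]; exact: recursive_nth.
  by apply: recursive_succ; apply: (recursive_computable1 rd); exact: recursive_nth.
- move=> w n.
  suff B2 : (2 * B n (mkseq w n) <= B n.+1 (mkseq w n.+1))%N.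
    rewrite ler_pdivrMr ?exprn_gt0 // mulrAC ler_pdivlMr ?exprn_gt0 //.
    by rewrite -!natrX -!natrM ler_nat expnS mulnA leq_mul2r mulnC B2 orbT.
  case: (posnP (B n (mkseq w n))) => [->//|/B_gt0[k [kn ek uk ->]]].
  (* Twice the integer part of z is at most the integer part of 2z. *)
  have le : (v n k * 2 <= v n.+1 k)%N.
    rewrite /v leq_divRL // mulnAC expnSr mulnA leq_mul2r /=.
    exact: leq_trunc_div.
  rewrite mulnC; apply: leq_trans le _; apply: B_ge => //; first exact: ltnW.
  by apply: prefix_trans uk _; exact: prefix_mkseq.
move=> w; pose S := ereal_sup (range (fun n => ((B n (mkseq w n))%:R / 2 ^+ n : R)%:E)).
have p0 n : 0 < 2 ^+ n :> R by rewrite exprn_gt0.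
have vE n k : (v n k)%:R / 2 ^+ n <= Num.max 0 (ratr (q k)) :> R.
  rewrite ler_pdivrMr // qE -/(rat_of _ _ _) ratr_rat_of.
  have /andP[le _] := natr_divn_bounds R ((a k - b k) * 2 ^ n) (d k).
  apply: le_trans le _.
  rewrite natrM natrX natrB_trunc mulrAC; apply: ler_wpM2r; first exact: ltW.
  by rewrite maxr_pMl ?mul0r // invr_ge0 ler0n.
have v_lt n k : ratr (q k) * 2 ^+ n < (v n k)%:R + 1 :> R.
  rewrite qE -/(rat_of _ _ _) ratr_rat_of.
  have /andP[_] := natr_divn_bounds R ((a k - b k) * 2 ^ n) (d k).
  apply: le_lt_trans; rewrite natrM natrX natrB_trunc [leRHS]mulrAC.
  apply: ler_wpM2r; first exact: ltW.
  apply: ler_wpM2r; first by rewrite invr_ge0 ler0n.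
  by rewrite le_max lexx orbT.
apply/eqP; rewrite eq_le; apply/andP; split; last first.
  apply: ge_ereal_sup => _ [n _ <-].
  case: (posnP (B n (mkseq w n))) => [->|/B_gt0[k [kn ek uk ->]]].
    by rewrite mul0r.
  apply: (@le_trans _ _ (Num.max 0 (ratr (q k)))%:E); first by rewrite lee_fin.
  rewrite EFin_max ge_max t0 /=; apply: ltW.
  have : (\bigcup_(x in [set x | W (x, q k)]) cylinder x) w.
    exists (u k); first by apply/WE; exists k.
    have := size_prefix uk; rewrite size_mkseq => sz.
    by apply/(cylinder_prefix w sz).
  by rewrite -tW.
(* If [S] were below [t w], a rational [r] strictly between them would be listed at some step [k].
   At a late stage rounding loses less than [r - S], so this stage would exceed [S]. *)
rewrite -/S leNgt; apply/negP => St.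
have S0 : (0 <= S)%E by apply: ereal_sup_ubound; exists 0%N => //; rewrite /B big_ord0 mul0r.
have [s sE] : exists s, S = s%:E.
  case E: S S0 St => [s| |] // _; first by exists s.
  by rewrite ltNge leey.
rewrite sE in St; have [r sr rt] := rat_between St.
have [x Wx xw] : (\bigcup_(x in [set x | W (x, r)]) cylinder x) w by rewrite -tW.
have /WE[k [ek uk qk]] := Wx.
have [|n0 n0P] := @half_pow_lt R (ratr r - s); first by rewrite subr_gt0.
have [n [nn0 nk nx]] : exists n, [/\ (n0 <= n)%N, (k < n)%N & (size x <= n)%N].
  exists (maxn n0 (maxn k.+1 (size x))).
  by rewrite leq_maxl !leq_max ltnSn leqnn ?orbT.
have Bn : (v n k <= B n (mkseq w n))%N.
  by apply: B_ge => //; rewrite uk; apply/(cylinder_prefix w nx).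
have : (B n (mkseq w n))%:R / 2 ^+ n <= s :> R.
  by rewrite -lee_fin -sE; apply: ereal_sup_ubound; exists n.
have := n0P n nn0; have := v_lt n k; rewrite qk.
rewrite ler_pdivrMr // -(ltr_pM2r (p0 n)) mulVf ?gt_eqF // mulrBl.
have : (v n k)%:R <= (B n (mkseq w n))%:R :> R by rewrite ler_nat.
lra.
Qed.

(** * Tests on sequences *)

Lemma rat_ofP r : exists a b d, rat_of a b d = r.
Proof.
have [D DE] : exists D, denq r = D.+1%:Z.
  by have := denq_gt0 r; case: (denq r) => [[|D]|] //; exists D.
have := divq_num_den r; rewrite DE; case: (numq r) => n <-.
  by exists n, 0%N, D; rewrite /rat_of subr0.
by exists 0%N, n.+1, D; rewrite /rat_of sub0r NegzE mulrNz.
Qed.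

Lemma cylinder_nil : cylinder [::] = setT.
Proof. by apply/seteqP; split. Qed.

Lemma measurable_lower_semicomputable (R : realType) (t : Omega -> \bar R) D :
  (forall w, (0 <= t w)%E) -> lower_semicomputable_Omega t -> measurable_fun D t.
Proof.
move=> t0 /(lower_semicomputable_stages t0)[B [_ B_nd tE]].
apply: (measurable_fun_sup (F := fun n y => ((B n y)%:R / 2 ^+ n)%:E)) => //.
Qed.

Section tests.
Variables (R : realType) (P : probability Omega R).

Lemma expectation_bounded_sup (T : word -> \bar R) : extended_test P T ->
  expectation_bounded_test P (fun w => ereal_sup (range (fun n => T (mkseq w n)))).
Proof.
move=> [T0 lscT T_nd T1]; split.
- by move=> w; apply: le_trans (T0 [::]) _; apply: ereal_sup_ubound; exists 0%N.
(* The supremum along [w] exceeds r exactly when some prefix x of [w] has r < T(x), so the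
   enumeration given for [T] serves again. *)
- exists [set z | ((ratr z.2)%:E < T z.1)%E] => // r; apply/seteqP; split=> w /=.
    move=> /ereal_sup_gtP[_ [n _ <-] rT]; exists (mkseq w n) => //.
    by rewrite /cylinder /= size_mkseq.
  move=> [x /= rT /cylinderP xw]; apply/ereal_sup_gtP.
  by exists (T x) => //; exists (size x) => //; rewrite xw.
(* An integral above 1 would, by [lt_integral_sup] at the empty word, give a length at which the
   expectation of [T] exceeds 1. *)
rewrite leNgt -cylinder_nil; apply/negP.
have T_nd' w n : (T (mkseq w n) <= T (mkseq w n.+1))%E.
  by apply: T_nd; exact: prefix_mkseq.
move=> /(lt_integral_sup P (F := fun=> T) (fun=> T0) T_nd' (fun=> erefl))[n _].
rewrite ltNge; apply/negP/negPn; apply: le_trans (T1 n).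
by under eq_bigl do rewrite prefix0s.
Qed.

Lemma extended_test_dominated_average (T : word -> \bar R) t :
  (forall x, 0 < wmeasure P x) -> extended_test P T ->
  universal_expectation_bounded_test P t -> dominated T (test_average P t).
Proof.
move=> P_pos extT [[t0 lsct _] univ].
have [c c0 cT] := univ _ (expectation_bounded_sup extT).
have [T0 _ _ _] := extT.
have mt D : measurable_fun D t by exact: measurable_lower_semicomputable.
exists c => // x; have mx := measurable_cylinder x.
have le : (T x * (wmeasure P x)%:E <= c%:E * \int[P]_(w in cylinder x) t w)%E.
  rewrite wmeasureE -integral_cst // -ge0_integralZl //; last first.
    by rewrite lee_fin ltW.
  apply: ge0_le_integral => //.
  - by move=> w _; exact: T0.
  - exact: measurable_funeM.
  move=> w /cylinderP xw; apply: le_trans (cT w).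
  by apply: ereal_sup_ubound; exists (size x) => //; rewrite xw.
rewrite /test_average muleCA.
apply: le_trans (lee_wpmul2l _ le); last by rewrite lee_fin invr_ge0 ltW.
by rewrite muleCA -EFinM mulVf ?mule1 // gt_eqF.
Qed.

(** The lower approximations of the [p i] fall short by at most 3 / 2^m, so the weighted sum falls
    short by at most C / 2^m with C three times the sum of the weights. This is less than a given
    gap for m large. *)
Lemma lt_sum_approx N (p : 'I_N -> R) (l : 'I_N -> nat -> nat) (c : 'I_N -> nat) :
  (forall i m, (l i m)%:R / 2 ^+ m <= p i <= (l i m + 3)%:R / 2 ^+ m) ->
  forall r, r < \sum_i p i * (c i)%:R <->
    exists m, r * 2 ^+ m < (\sum_i l i m * c i)%N%:R.
Proof.
move=> lp r; have p0 m : 0 < 2 ^+ m :> R by rewrite exprn_gt0.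
have lowE m : (\sum_i l i m * c i)%N%:R <= (\sum_i p i * (c i)%:R) * 2 ^+ m :> R.
  rewrite natr_sum mulr_suml; apply: ler_sum => i _.
  rewrite natrM mulrAC; apply: ler_wpM2r => //.
  by have /andP[] := lp i m; rewrite ler_pdivrMr.
split=> [rs|[m rm]]; last first.
  by rewrite -(ltr_pM2r (p0 m)); exact: lt_le_trans (lowE m).
pose C := (3 * \sum_i c i)%N.
have [|m /(_ m (leqnn m)) mP] :=
    @half_pow_lt R ((\sum_i p i * (c i)%:R - r) / C.+1%:R).
  by rewrite divr_gt0 // subr_gt0.
exists m.
have : (\sum_i p i * (c i)%:R) * 2 ^+ m <= (\sum_i l i m * c i)%N%:R + C%:R :> R.
  rewrite /C big_distrr -natrD -big_split natr_sum mulr_suml /=; apply: ler_sum => i _.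
  rewrite -mulnDl natrM mulrAC; apply: ler_wpM2r => //.
  by have /andP[_] := lp i m; rewrite ler_pdivlMr.
rewrite ltr_pdivlMr ?ltr0n // mulrC ltr_pdivrMr // in mP.
by move: mP; rewrite mulrBl -natr1; lra.
Qed.

(** * The semimeasure obtained by integrating a test *)

Section semimeasure_of_test.
Variable t : Omega -> \bar R.
Hypotheses (t0 : forall w, (0 <= t w)%E) (lsct : lower_semicomputable_Omega t).
Hypothesis t1 : (\int[P]_w t w <= 1)%E.

Let I x := (\int[P]_(w in cylinder x) t w)%E.

Let mt (D : set Omega) : measurable_fun D t.
Proof. exact: measurable_lower_semicomputable. Qed.

Let I_ge0 x : (0 <= I x)%E.
Proof. exact: integral_ge0. Qed.

Let I_le1 x : (I x <= 1)%E.
Proof.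
apply: le_trans t1; apply: ge0_subset_integral => //; exact: measurable_cylinder.
Qed.

Let I_fin x : I x \is a fin_num.
Proof.
rewrite ge0_fin_numE //; apply: le_lt_trans (I_le1 x) _; exact: ltry.
Qed.

Let I_split x : I x = (I (rcons x false) + I (rcons x true))%E.
Proof.
rewrite /I -ge0_integral_setU //; first last.
- apply/disj_setPS => w [] /cylinderP; rewrite size_rcons => wf /cylinderP.
  by rewrite size_rcons wf => /rcons_inj[].
- exact: measurable_cylinder.
- exact: measurable_cylinder.
congr (integral _ _ _); apply/seteqP; split=> w.
  move=> /cylinderP xw; case wx: (w (size x)); [right|left]; apply/cylinderP;
  by rewrite size_rcons mkseqS xw wx.
by move=> [] /cylinderP; rewrite size_rcons mkseqS => /rcons_inj[].
Qed.

(* A semimeasure takes the value 1 at the empty word, while the integral of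
   [t] may be smaller. *)
Definition test_semimeasure (x : word) : R :=
  if x is [::] then 1 else fine (\int[P]_(w in cylinder x) t w).

Lemma test_semimeasure_ge x :
  (\int[P]_(w in cylinder x) t w <= (test_semimeasure x)%:E)%E.
Proof. by case: x => [|b x]; [exact: I_le1|rewrite /test_semimeasure -/(I _) fineK]. Qed.

Lemma semimeasure_test_semimeasure : semimeasure test_semimeasure.
Proof.
have E x b : test_semimeasure (rcons x b) = fine (I (rcons x b)).
  by case: x.
split=> // [x|x].
  by rewrite -lee_fin; apply: le_trans (test_semimeasure_ge x); exact: I_ge0.
(* The integrals add up exactly; a loss can only come from the value 1 at the empty word. *)
rewrite !E -lee_fin EFinD !fineK // -I_split; exact: test_semimeasure_ge.
Qed.

Lemma lower_semicomputable_test_semimeasure : computable_measure P ->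
  lower_semicomputable (EFin \o test_semimeasure).
Proof.
move=> /wmeasure_approx[L [rL LP]].
have [B [rB B_nd tE]] := lower_semicomputable_stages t0 lsct.
pose y n i := word_of (i + (2 ^ n).-1).
(* [S x n m / 2 ^ (n + m)] approximates the integral over the cylinder of [x] from below: [n] is the
   stage for [t] and the length of the cylinders, [m] the precision for their measures. *)
pose S x n m := (\sum_(i < 2 ^ n)
  L (y n i) m * (prefix x (y n i) * B n (y n i)))%N.
have p0 n : 0 < 2 ^+ n :> R by rewrite exprn_gt0.
have IP x (r : R) : (r%:E < I x)%E <->
    exists n m, (size x <= n)%N /\ r * 2 ^+ (n + m) < (S x n m)%:R.
  have nd w n : (((B n (mkseq w n))%:R / 2 ^+ n : R)%:E <=
      ((B n.+1 (mkseq w n.+1))%:R / 2 ^+ n.+1)%:E)%E.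
    by rewrite lee_fin.
  have F0 n z : (0 <= ((B n z)%:R / 2 ^+ n : R)%:E)%E.
    by rewrite lee_fin divr_ge0 // ltW.
  have sumE n : (\sum_(z : n.-tuple bool | prefix x z)
      (wmeasure P z)%:E * ((B n z)%:R / 2 ^+ n)%:E =
      ((\sum_(i < 2 ^ n) wmeasure P (y n i) *
        (prefix x (y n i) * B n (y n i))%N%:R) / 2 ^+ n)%:E)%E.
    under eq_bigr do rewrite -EFinM mulrA.
    rewrite sumEFin -mulr_suml big_mkcond /=.
    rewrite (sum_words n (fun z => if prefix x z then wmeasure P z * (B n z)%:R else 0)).
    congr (_ / _)%:E; apply: eq_bigr => i _.
    by case: ifP => _; rewrite ?mul1n // mul0n mulr0.
  rewrite /I (lt_integral_sup P F0 nd tE); split.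
    move=> [n xn]; rewrite sumE lte_fin ltr_pdivlMr //.
    move=> /(lt_sum_approx _ (fun i : 'I_(2 ^ n) => LP (y n i)))[m rm].
    by exists n, m; split=> //; rewrite exprD mulrA.
  move=> [n [m [xn rm]]]; exists n => //; rewrite sumE lte_fin ltr_pdivlMr //.
  apply/(lt_sum_approx _ (fun i : 'I_(2 ^ n) => LP (y n i))).
  by exists m; rewrite -mulrA -exprD.
(* The rational is (a - b) / (d + 1); clearing the denominator and moving [b] to the right leaves
   natural numbers. At the empty word the comparison is with 1. *)
pose E v := let x := nth 0%N v 0 in let a := nth 0%N v 1 in let b := nth 0%N v 2 in
  let d := nth 0%N v 3 in let n := nth 0%N v 4 in let m := nth 0%N v 5 in
  (((x == 0) && (a < d.+1 + b)) || (~~ (x == 0) && ((size (word_of x) <= n) &&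
    (a * 2 ^ (n + m) < S (word_of x) n m * d.+1 + b * 2 ^ (n + m)))))%N.
have r_lt a b d z (s : R) : ((ratr (rat_of a b d) : R) * z < s) =
    (a%:R * z < s * d.+1%:R + b%:R * z).
  rewrite ratr_rat_of mulrAC ltr_pdivrMr ?ltr0n // mulrBl ltrBlDr //.
apply: (@enumerable_sigma1 6 E).
  have rnth i : recursive 6 (fun v => nth 0%N v i) by exact: recursive_nth.
  have rpow : recursive 6 (fun v => 2 ^ (nth 0 v 4 + nth 0 v 5))%N.
    by apply: recursive_exp2; exact: recursive_add.
  apply: recursive_orb; apply: recursive_andb.
  - by apply: recursive_eq => //; exact: recursive_const.
  - apply: recursive_leq; first exact: recursive_succ.
    by apply: recursive_add => //; exact: recursive_succ.
  - by apply: recursive_negb; apply: recursive_eq => //; exact: recursive_const.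
  - apply: recursive_andb.
      by apply: recursive_leq => //; exact: recursive_size.
    apply: recursive_leq.
      by apply: recursive_succ; apply: recursive_mul.
    apply: recursive_add; last exact: recursive_mul.
    apply: recursive_mul; last exact: recursive_succ.
    pose yc u := (nth 0 u 0 + (2 ^ nth 0 u 5).-1)%N.
    apply: (recursive_sum (F := fun u => L (word_of (yc u)) (nth 0 u 6) *
      (prefix (word_of (nth 0 u 1)) (word_of (yc u)) * B (nth 0 u 5) (word_of (yc u)))))%N.
      exact: recursive_exp2.
    have rnth7 i : recursive 7 (fun v => nth 0%N v i) by exact: recursive_nth.
    have ryc : recursive 7 yc.
      by apply: recursive_add => //; apply: recursive_pred; exact: recursive_exp2.
    apply: recursive_mul.
      by apply: (recursive2 (f := fun i m => L (word_of i) m)).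
    apply: recursive_mul; first exact: recursive_prefix.
    by apply: (recursive2 (f := fun n i => B n (word_of i))).
have EP x a b d n m : E [:: word_code x; a; b; d; n; m] <->
    if x is [::] then ratr (rat_of a b d) < 1 :> R else
    (size x <= n)%N /\ ratr (rat_of a b d) * 2 ^+ (n + m) < (S x n m)%:R :> R.
  rewrite /E /= word_codeK r_lt -natrX -!natrM -natrD ltr_nat.
  case: x => [|c x] /=; last by split=> [/andP|] // [-> ->].
  by rewrite orbF -[ratr _]mulr1 r_lt mul1r !mulr1 -natrD ltr_nat.
have MP x a b d : ratr (rat_of a b d) < test_semimeasure x <->
    exists n m, E [:: word_code x; a; b; d; n; m].
  case: x => [|c x].
    split=> [rt|[n [m /(EP [::])]]] //; exists 0%N, 0%N; exact/(EP [::]).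
  rewrite /test_semimeasure -lte_fin -/(I _) fineK //.
  split=> [/IP[n [m H]]|[n [m /(EP (c :: x)) H]]].
    by exists n, m; apply/(EP (c :: x)).
  by apply/IP; exists n, m.
move=> x r /=; rewrite lte_fin; split=> [rM|[v [vk Ev <- <-]]].
  have [a [b [d rE]]] := rat_ofP r; rewrite -rE in rM.
  have [n [m Ev]] := proj1 (MP x a b d) rM.
  by exists [:: word_code x; a; b; d; n; m]; split=> //=; rewrite word_codeK.
case: v vk Ev => [|x' [|a [|b [|d [|n [|m [|]]]]]]] //= _ Ev.
by apply/MP; exists n, m; rewrite word_ofK.
Qed.

End semimeasure_of_test.
End tests.

(** * The test derived from the discrete a priori probability *)

Lemma prefix_comparable (T : eqType) (x y z : seq T) :
  prefix x z -> prefix y z -> prefix x y || prefix y x.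
Proof.
rewrite !prefixE => /eqP xz /eqP yz; case: (leqP (size x) (size y)) => le.
  by apply/orP; left; rewrite -[X in take _ X]yz take_takel // xz.
by apply/orP; right; rewrite -[X in take _ X]xz take_takel ?yz // ltnW.
Qed.

Lemma card_extensions n (x : word) : (size x <= n)%N ->
  (2 ^ (n - size x) <= #|[pred z : n.-tuple bool | prefix x z]|)%N.
Proof.
move=> xn; pose f (z : (n - size x).-tuple bool) : n.-tuple bool :=
  insubd [tuple false | i < n] (x ++ z).
have fE z : tval (f z) = x ++ z.
  by rewrite -[LHS]/(val (f z)) val_insubd size_cat size_tuple subnKC // eqxx.
have f_inj : injective f.
  move=> y z /(congr1 (fun t => tval t)); rewrite !fE => /eqP.
  by rewrite eqseq_cat // eqxx => /eqP/val_inj.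
rewrite -card_bool -card_tuple -(card_imset _ f_inj); apply: subset_leq_card.
by apply/fintype.subsetP => _ /imsetP[z _ ->]; rewrite inE fE prefix_prefix.
Qed.

(** Extend all words to the common length [n]: a word of length l has at least 2^(n-l) extensions,
    and no extension is shared, since two prefixes of one word are comparable. *)
Lemma kraft (R : realType) (I : finType) (D : pred I) (p : I -> word) :
  (forall i j, D i -> D j -> prefix (p i) (p j) -> i = j) ->
  \sum_(i | D i) 2 ^- size (p i) <= 1 :> R.
Proof.
move=> pD; pose n := (\max_i size (p i))%N.
have pn i : (size (p i) <= n)%N by exact: bigop.leq_bigmax.
have n0 : 0 < 2 ^+ n :> R by rewrite exprn_gt0.
rewrite -(ler_pM2r n0) mul1r mulr_suml.
apply: (@le_trans _ _ (\sum_(i | D i) (\sum_(z : n.-tuple bool | prefix (p i) z) 1)%N%:R)).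
  apply: ler_sum => i _; rewrite sum1_card mulrC -expfB_cond ?pnatr_eq0 //.
    by rewrite -natrX ler_nat; exact: card_extensions.
  by rewrite pn.
rewrite -natr_sum -natrX ler_nat (exchange_big_dep predT) //=.
rewrite -card_bool -card_tuple -sum1_card; apply: leq_sum => z _.
case: (pickP (fun i => D i && prefix (p i) z)) => [i /andP[Di iz]|none].
  rewrite (big_pred1 i) // => j; apply/andP/eqP => [[Dj jz]|->] //.
  by have /orP[/pD->|/pD->] := prefix_comparable jz iz.
by rewrite big_pred0.
Qed.

Section apriori.
Variables (R : realType) (U : word -> option word).

(** Lengths are natural numbers, so the infimum is attained as soon as a program exists; otherwise
    it is +oo and the weight is 0. *)
Lemma discrete_aprioriP y :
  ((forall p, U p <> Some y) /\ discrete_apriori R U y = 0%E) \/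
  exists p, [/\ U p = Some y, discrete_apriori R U y = (2 ^- size p)%:E
    & forall p', U p' = Some y -> (size p <= size p')%N].
Proof.
have [ex|nex] := pselect (exists p, U p = Some y); last first.
  left; split=> [p Up|]; first by apply: nex; exists p.
  rewrite /discrete_apriori /complexity.
  suff -> : [set p | U p = Some y] = set0 by rewrite image_set0 ereal_inf0.
  by apply/seteqP; split=> // p Up; apply: nex; exists p.
right; pose Q n := `[< exists2 p, U p = Some y & size p = n >].
have exQ : exists n, Q n by have [p Up] := ex; exists (size p); apply/asboolP; exists p.
case: (ex_minnP exQ) => _ /asboolP[p Up <-] minp.
have {}minp p' : U p' = Some y -> (size p <= size p')%N.
  by move=> Up'; apply: minp; apply/asboolP; exists p'.
exists p; split=> //; rewrite /discrete_apriori.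
suff -> : complexity R U y = (size p)%:R%:E by rewrite powRN powR_mulrn.
apply/eqP; rewrite eq_le; apply/andP; split.
  by apply: ereal_inf_lbound; exists p.
by apply/ereal_infP => _ [p' Up' <-]; rewrite lee_fin ler_nat; exact: minp.
Qed.

(** Chosen shortest programs of distinct words are prefix-incomparable, so Kraft's inequality
    applies to them. *)
Lemma sum_discrete_apriori_le1 n : prefix_machine U ->
  (\sum_(j < n) discrete_apriori R U (word_of j) <= 1)%E.
Proof.
move=> [_ U_free]; pose D (j : 'I_n) := `[< exists p, U p = Some (word_of j) >].
have /choice[p pP] (j : 'I_n) : exists p, D j ->
    U p = Some (word_of j) /\ discrete_apriori R U (word_of j) = (2 ^- size p)%:E.
  case: (discrete_aprioriP (word_of j)) => [[nU _]|[p [Up mE _]]]; last by exists p.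
  by exists [::] => /asboolP[q /nU].
rewrite (bigID D) /= [X in (_ + X)%E]big1 ?adde0; last first.
  move=> j nD; case: (discrete_aprioriP (word_of j)) => [[]//|[q [Uq _ _]]].
  by case/negP: nD; apply/asboolP; exists q.
under eq_bigr => j Dj do rewrite (proj2 (pP j Dj)).
rewrite sumEFin lee_fin; apply: kraft => i j Di Dj pij.
have [Ui _] := pP i Di; have [Uj _] := pP j Dj.
have : p i = p j by apply: U_free => //; rewrite ?Ui ?Uj.
move=> pE; move: Ui; rewrite pE Uj => -[/(congr1 word_code)].
by rewrite !word_ofK => /val_inj.
Qed.

End apriori.

Section apriori_test.
Variables (R : realType) (P : probability Omega R).
Hypothesis P_pos : forall x, 0 < wmeasure P x.
Variable U : word -> option word.
Hypothesis U_prefix : prefix_machine U.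

Definition apriori_ratio (y : word) : \bar R :=
  (discrete_apriori R U y * (wmeasure P y)^-1%:E)%E.

(** The ratio m/P need not be monotone; this is its least monotone majorant. *)
Definition apriori_test (x : word) : \bar R :=
  ereal_sup ([set 0%E] `|` [set apriori_ratio y | y in [set y | prefix y x]]).

Lemma apriori_test_ge0 x : (0 <= apriori_test x)%E.
Proof. by apply: ereal_sup_ubound; left. Qed.

Lemma apriori_test_ge x : (apriori_ratio x <= apriori_test x)%E.
Proof. by apply: ereal_sup_ubound; right; exists x => //=; exact: prefix_refl. Qed.

(** Any program of [y] is accepted as a witness, since for r >= 0 a longer one only makes the
    inequality harder to satisfy. Minimality of programs, which cannot be enumerated, is thereby
    avoided. *)
Lemma lt_apriori_test x (r : R) : (r%:E < apriori_test x)%E <->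
  r < 0 \/ exists y p, [/\ prefix y x, U p = Some y & r * wmeasure P y < 2 ^- size p].
Proof.
split=> [/ereal_sup_gtP[_ [->|[y yx <-]]]|].
- by left.
- rewrite /apriori_ratio; case: (discrete_aprioriP R U y) => [[_ ->]|[p [Up -> _]]].
    by rewrite mul0e; left.
  rewrite -EFinM lte_fin ltr_pdivlMr // => rlt.
  by right; exists y, p.
move=> [r0|[y [p [yx Up rlt]]]].
  by apply: lt_le_trans (apriori_test_ge0 x); rewrite lte_fin.
apply/ereal_sup_gtP; exists (apriori_ratio y); first by right; exists y.
rewrite /apriori_ratio; case: (discrete_aprioriP R U y) => [[/(_ p)]|[q [_ -> le]]] //.
rewrite -EFinM lte_fin ltr_pdivlMr //; apply: lt_le_trans rlt _.
rewrite lef_pV2 ?posrE ?exprn_gt0 //; apply: ler_weXn2l; first by rewrite ler1n.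
exact: le.
Qed.

Lemma le_apriori_test x y : prefix x y -> (apriori_test x <= apriori_test y)%E.
Proof.
move=> xy; apply: le_ereal_sup => _ [->|[z zx <-]]; first by left.
by right; exists z => //=; exact: prefix_trans xy.
Qed.

Lemma sum_apriori_test n :
  (\sum_(x : n.-tuple bool) (wmeasure P x)%:E * apriori_test x <= 1)%E.
Proof.
pose m y := fine (discrete_apriori R U y).
have mE y : discrete_apriori R U y = (m y)%:E.
  by rewrite /m; case: (discrete_aprioriP R U y) => [[_ ->]|[p [_ -> _]]].
have m0 y : 0 <= m y.
  by rewrite /m; case: (discrete_aprioriP R U y) => [[_ ->]|[p [_ -> _]]] //.
pose c (x : word) (j : nat) : R :=
  if prefix (word_of j) x then m (word_of j) / wmeasure P (word_of j) else 0.
have c0 x j : 0 <= c x j by rewrite /c; case: ifP => // _; rewrite divr_ge0 // ltW.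
(* Every word of length at most [n] has its code below this bound. *)
pose N := (2 ^ n.+1)%N.
apply: (@le_trans _ _ (\sum_(x : n.-tuple bool) wmeasure P x * \sum_(j < N) c x j)%:E).
  rewrite -sumEFin; apply: lee_sum => x _; rewrite EFinM.
  apply: lee_wpmul2l; first by rewrite lee_fin ltW.
  apply: ge_ereal_sup => _ [->|[y /= yx <-]]; first by rewrite lee_fin sumr_ge0.
  have yN : (word_code y < N)%N.
    have /andP[_] := word_code_bounds y; move=> /ltnW; move/leq_trans; apply.
    by rewrite leq_exp2l // ltnS -(size_tuple x); exact: size_prefix.
  rewrite /apriori_ratio mE -EFinM lee_fin (bigD1 (Ordinal yN)) //=.
  have -> : c x (word_code y) = m y / wmeasure P y by rewrite /c word_codeK yx.
  by rewrite lerDl sumr_ge0.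
under eq_bigr do rewrite mulr_sumr.
rewrite exchange_big /=.
apply: le_trans (sum_discrete_apriori_le1 R N U_prefix).
rewrite -sumEFin; apply: lee_sum => j _; rewrite mE lee_fin.
pose y := word_of j; rewrite -/y.
have -> : \sum_(x : n.-tuple bool) wmeasure P x * c x j =
    (\sum_(x : n.-tuple bool | prefix y x) wmeasure P x) * (m y / wmeasure P y).
  rewrite mulr_suml [RHS]big_mkcond; apply: eq_bigr => x _.
  by rewrite /c -/y; case: ifP => // _; rewrite mulr0.
(* The measures of the extensions of [y] add up to P(y), which cancels the denominator. The last
   code below [N] belongs to a word of length n + 1, whose sum is empty. *)
case: (leqP (size y) n) => yn.
  by rewrite sum_wmeasure_prefix // mulrC divfK // gt_eqF.
rewrite big_pred0 ?mul0r // => x; apply/negP => /size_prefix.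
by rewrite size_tuple leqNgt yn.
Qed.

Lemma lower_semicomputable_apriori_test : computable_measure P ->
  lower_semicomputable apriori_test.
Proof.
move=> /wmeasure_approx[L [rL LP]].
have [[u uP] _] := U_prefix; have [F fF rF] := fueled_exists u 1.
have UP p y : U p = Some y <-> exists s, F [:: s; word_code p] = (word_code y).+1.
  have [F1 F2] := fF [:: word_code p] erefl.
  rewrite uP; split=> [/F2[s /(_ s (leqnn s)) sE]|[s /F1]] //; by exists s.
have p0 n : 0 < 2 ^+ n :> R by rewrite exprn_gt0.
(* Here [P] is needed from above: the upper approximation (L + 3) / 2^k exceeds P(y) by at most 3 /
   2^k, so a strict inequality survives at some precision [k]. *)
have ltP (r : R) y (p : word) : 0 <= r -> r * wmeasure P y < 2 ^- size p <->
    exists k, r * (L y k + 3)%:R * 2 ^+ size p < 2 ^+ k.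
  move=> r0; set p' := 2 ^+ size p; have p'0 : 0 < p' by exact: p0.
  rewrite -[_^-1]mul1r ltr_pdivlMr //; split=> [lt|[k lt]].
    have [|k /(_ k (leqnn k)) kP] :=
        @half_pow_lt R ((1 - r * wmeasure P y * p') / (3 * r * p' + 1)).
      by rewrite divr_gt0 ?subr_gt0 // ltr_wpDl // !mulr_ge0 // ltW.
    exists k; have q0 : 0 < 3 * r * p' + 1 by rewrite ltr_wpDl // !mulr_ge0 // ltW.
    rewrite ltr_pdivlMr // mulrC ltr_pdivrMr // in kP.
    have /andP[+ _] := LP y k; rewrite ler_pdivrMr // => Lk.
    have : r * p' * (L y k)%:R <= r * p' * (wmeasure P y * 2 ^+ k).
      by apply: ler_wpM2l => //; rewrite mulr_ge0 // ltW.
    by rewrite natrD; lra.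
  rewrite -(ltr_pM2r (p0 k)) mul1r; apply: le_lt_trans lt.
  rewrite -!mulrA; apply: ler_wpM2l => //; rewrite mulrA [leLHS]mulrAC.
  apply: ler_wpM2r; first exact: ltW.
  by have /andP[_] := LP y k; rewrite ler_pdivlMr.
(* The witnesses are a program [p] of the word coded by [y], a fuel [s] for its run and a precision
   [k]. A negative rational ([a < b]) is accepted at once; otherwise the truncated [a - b] is
   exact. *)
pose E v := let x := nth 0%N v 0 in let a := nth 0%N v 1 in let b := nth 0%N v 2 in
  let d := nth 0%N v 3 in let p := nth 0%N v 4 in let y := nth 0%N v 5 in
  let s := nth 0%N v 6 in let k := nth 0%N v 7 in
  ((a < b) || ((F [:: s; p] == y.+1) && (prefix (word_of y) (word_of x) &&
    ((a - b) * (L (word_of y) k + 3) * 2 ^ size (word_of p) < d.+1 * 2 ^ k))))%N.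
apply: (@enumerable_sigma1 8 E).
  have rnth i : recursive 8 (fun v => nth 0%N v i) by exact: recursive_nth.
  apply: recursive_orb; first by apply: recursive_leq => //; exact: recursive_succ.
  apply: recursive_andb.
    apply: recursive_eq; last exact: recursive_succ.
    exact: (recursive_comp (gs := [:: (nth 0%N)^~ 6; (nth 0%N)^~ 4]) rF).
  apply: recursive_andb; first exact: recursive_prefix.
  apply: recursive_leq; last first.
    by apply: recursive_mul; [exact: recursive_succ|exact: recursive_exp2].
  apply: recursive_succ; apply: recursive_mul; last first.
    by apply: recursive_exp2; exact: recursive_size.
  apply: recursive_mul; first exact: recursive_sub.
  apply: recursive_add; last exact: recursive_const.
  exact: (recursive2 (f := fun i m => L (word_of i) m)).
have neg a b d : ((ratr (rat_of a b d) : R) < 0) = (a < b)%N.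
  by rewrite ratr_rat_of pmulr_llt0 ?invr_gt0 ?ltr0n // subr_lt0 ltr_nat.
have rE a b d y k (p : word) : (b <= a)%N ->
    ((ratr (rat_of a b d) : R) * (L y k + 3)%:R * 2 ^+ size p < 2 ^+ k) =
    ((a - b) * (L y k + 3) * 2 ^ size p < d.+1 * 2 ^ k)%N.
  move=> ba; rewrite ratr_rat_of -natrB // -!natrX [_ / _ * _]mulrAC.
  rewrite [_ / _ * _]mulrAC ltr_pdivrMr ?ltr0n // -!natrM ltr_nat.
  by rewrite [(d.+1 * _)%N]mulnC.
have EP x a b d : ((ratr (rat_of a b d))%:E < apriori_test x)%E <->
    exists p y s k, E [:: word_code x; a; b; d; p; y; s; k].
  rewrite lt_apriori_test neg.
  case: (ltnP a b) => ab.
    split=> _; last by left.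
    by exists 0%N, 0%N, 0%N, 0%N; rewrite /E /= ab.
  have r0 : 0 <= (ratr (rat_of a b d) : R) by rewrite leNgt neg -leqNgt.
  rewrite /E /= ltnNge ab /=; split=> [[//|[y [p [yx Up]]]]|[p [y [s [k]]]]].
    move=> /(ltP _ y p r0)[k]; rewrite rE // => kP.
    have [s sP] := proj1 (UP p y) Up.
    by exists (word_code p), (word_code y), s, k; rewrite sP eqxx !word_codeK yx kP.
  rewrite word_codeK => /and3P[/eqP Fs yx kP]; right.
  exists (word_of y), (word_of p); split=> //.
    by apply/UP; exists s; rewrite !word_ofK.
  by apply/ltP => //; exists k; rewrite rE.
move=> x r /=; split=> [rM|[v [vk Ev <- <-]]].
  have [a [b [d rdE]]] := rat_ofP r; rewrite -rdE in rM.
  have [p [y [s [k Ev]]]] := proj1 (EP x a b d) rM.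
  by exists [:: word_code x; a; b; d; p; y; s; k]; split=> //=; rewrite word_codeK.
case: v vk Ev => [|x' [|a [|b [|d [|p [|y [|s [|k [|]]]]]]]]] //= _ Ev.
by apply/EP; exists p, y, s, k; rewrite word_ofK.
Qed.

Lemma extended_test_apriori_test : computable_measure P ->
  extended_test P apriori_test.
Proof.
move=> P_comp; split.
- exact: apriori_test_ge0.
- exact: lower_semicomputable_apriori_test.
- exact: le_apriori_test.
- exact: sum_apriori_test.
Qed.

End apriori_test.

(** * The three inequalities *)

Theorem theorem6 (R : realType) (P : probability Omega R)
    (P_computable : computable_measure P)
    (P_pos : forall x : word, 0 < wmeasure P x)
    (U : word -> option word) (U_optimal : optimal_prefix_machine R U)
    (tw : word -> \bar R) (tw_universal : universal_extended_test P tw)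
    (t : Omega -> \bar R) (t_universal : universal_expectation_bounded_test P t)
    (a : word -> R) (a_maximal : continuous_apriori a) :
  [/\ dominated (fun x => (discrete_apriori R U x * (wmeasure P x)^-1%:E)%E) tw,
      dominated tw (test_average P t)
    & dominated (test_average P t) (fun x => (a x / wmeasure P x)%:E)].
Proof.
have [U_prefix _] := U_optimal; have [tw_test tw_max] := tw_universal.
have [[t0 lsct t1] _] := t_universal; have [_ a_max] := a_maximal.
split.
- have [c c0 le] := tw_max _ (extended_test_apriori_test P_pos U_prefix P_computable).
  by exists c => // x; apply: le_trans (le x); exact: apriori_test_ge.
- exact: extended_test_dominated_average.
- have [c c0 le] := a_max (test_semimeasure P t)
    (conj (semimeasure_test_semimeasure t0 lsct t1)
      (lower_semicomputable_test_semimeasure t0 lsct t1 P_computable)).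
  exists c => // x; rewrite /test_average EFinM muleA [leRHS]muleC.
  apply: lee_wpmul2l; first by rewrite lee_fin invr_ge0 ltW.
  by apply: le_trans (le x); exact: test_semimeasure_ge.
Qed.
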